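(* Consider the matrix time series model described in the context under the alternative, with change location $u$ satisfying $\nu\le u\le N-\nu$ and $\|\boldsymbol\delta_N\|_\infty\le1$, and suppose Assumptions (A1) and (A2) hold. Fix $mode\in\{1,2\}$, let $s=p_2$ if $mode=1$, $s=p_1$ if $mode=2$, $\eta_N(s)=\big(D_N^2s^5\log^5(pN)/\nu\big)^{1/4}$, and fix $\alpha\in(0,1)$. There exist constants $c_1,c_2>0$ depending only on $b_1,b_2$ such that if $$\|\boldsymbol\delta_N\|_{[mode,2]}\ge c_1D_Ns^{1/2}\frac{\log^{1/2}(pN)+\log^{1/2}(2/\alpha)}{\{u(N-u)/N\}^{1/2}},$$ then $$\mathbb{P}\big(T_{[mode,2]}(\mathbf X)\ge\hat d_{1-\alpha,[mode,2]}\big)\ge1-c_2\eta_N(s)-2\exp(-\alpha^2B/2).$$ Consequently, if $D_N^2s^5\log^5(pN)=o(\nu)$, then $\mathbb{P}(T_{[mode,2]}(\mathbf X)\ge\hat d_{1-\alpha,[mode,2]})\to1$ as $N,B\to\infty$.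
   Context: Let $p_1,p_2,N$ be positive integers, $p=p_1p_2$, $p_{\max}=\max(p_1,p_2)$. Data $\mathbf X_i=\boldsymbol\mu+\boldsymbol\delta_N\mathbb{I}(i>u)+\boldsymbol\varepsilon_i\in\mathbb{R}^{p_1\times p_2}$, $i=1,\dots,N$, with $\boldsymbol\mu,\boldsymbol\delta_N\in\mathbb{R}^{p_1\times p_2}$, $1<u<N$, and $\boldsymbol\varepsilon_i$ independent zero-mean random matrices, $\mathrm{Cov}(\mathrm{vec}(\boldsymbol\varepsilon_i))=\Sigma$. CUSUM $\mathbf C_n(\mathbf X)=\sqrt{n(N-n)/N}\big(\frac{1}{N-n}\sum_{i>n}\mathbf X_i-\frac1n\sum_{i\le n}\mathbf X_i\big)$. Norms: $\|\mathbf A\|_{[1,2]}=\max_{j_1}(\sum_{j_2}a_{j_1j_2}^2)^{1/2}$, $\|\mathbf A\|_{[2,2]}=\max_{j_2}(\sum_{j_1}a_{j_1j_2}^2)^{1/2}$, $\|\mathbf A\|_\infty=\max_{j_1,j_2}|a_{j_1j_2}|$. For an integer $1<\nu<N/2$, $T_{[mode,2]}(\mathbf X)=\max_{\nu\le n\le N-\nu}\|\mathbf C_n(\mathbf X)\|_{[mode,2]}$. For $b=1,\dots,B$, $e^b_1,\dots,e^b_N$ are i.i.d. $\mathcal N(0,1)$, independent across $b$ and of $\mathbf X$; with $\bar{\mathbf X}_n^-=n^{-1}\sum_{i\le n}\mathbf X_i$, $\bar{\mathbf X}_n^+=(N-n)^{-1}\sum_{i>n}\mathbf X_i$, $\mathbf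 C^b_n(\mathbf X)=\sqrt{n(N-n)/N}\big(\frac{1}{N-n}\sum_{i>n}e^b_i(\mathbf X_i-\bar{\mathbf X}_n^+)-\frac1n\sum_{i\le n}e^b_i(\mathbf X_i-\bar{\mathbf X}_n^-)\big)$, $T^b_{[mode,2]}(\mathbf X)=\max_{\nu\le n\le N-\nu}\|\mathbf C^b_n(\mathbf X)\|_{[mode,2]}$, and $\hat d_{1-\alpha,[mode,2]}=\inf\{t:\frac1B\sum_{b}\mathbb{I}(T^b_{[mode,2]}(\mathbf X)\le t)\ge1-\alpha\}$. Constants $0<b_1\le b_2$, sequence $D_N\ge1$. (A1): $\mathbb{E}[\exp(|v^\top\mathrm{vec}(\boldsymbol\varepsilon_i)|/D_N)]\le2$ for all $v\in\mathbb{S}^{p-1}$ with $\|v\|_0\le p_{\max}$ and all $i$. (A2): $\mathbb{E}[(v^\top\mathrm{vec}(\boldsymbol\varepsilon_i))^2]\ge b_1^2$ and $\mathbb{E}[(v^\top\mathrm{vec}(\boldsymbol\varepsilon_i))^4]\le D_N^2b_2^2$ for all such $v,i$. *)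

(* Defs.v *)
From HB Require Import structures.
From mathcomp Require Import all_boot all_order all_algebra.
From mathcomp Require Import all_classical all_reals all_analysis.
Set Implicit Arguments. Unset Strict Implicit. Unset Printing Implicit Defensive.
Import Order.TTheory GRing.Theory Num.Theory.
Local Open Scope classical_set_scope.
Local Open Scope ring_scope.

Definition norm12 {R : realType} {p1 p2 : nat} (A : 'M[R]_(p1, p2)) : R :=
  \big[Order.max/0]_(j1 < p1) Num.sqrt (\sum_(j2 < p2) A j1 j2 ^+ 2).

Definition norm22 {R : realType} {p1 p2 : nat} (A : 'M[R]_(p1, p2)) : R :=
  \big[Order.max/0]_(j2 < p2) Num.sqrt (\sum_(j1 < p1) A j1 j2 ^+ 2).

Definition norminf {R : realType} {p1 p2 : nat} (A : 'M[R]_(p1, p2)) : R :=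
  \big[Order.max/0]_(j1 < p1) \big[Order.max/0]_(j2 < p2) `|A j1 j2|.

Definition norm_mode {R : realType} {p1 p2 : nat} (mode : nat)
  (A : 'M[R]_(p1, p2)) : R :=
  if mode == 1%N then norm12 A else norm22 A.

(* Observations are indexed by i : 'I_N, where i stands for the paper's
   index i+1 in {1,...,N}.  Thus "paper index <= n" is "i < n". *)

Definition cusum {R : realType} {p1 p2 N : nat}
  (X : 'I_N -> 'M[R]_(p1, p2)) (n : nat) : 'M[R]_(p1, p2) :=
  Num.sqrt (n%:R * (N - n)%:R / N%:R) *:
    ((N - n)%:R^-1 *: (\sum_(i < N | (n <= i)%N) X i)
     - n%:R^-1 *: (\sum_(i < N | (i < n)%N) X i)).

Definition mean_minus {R : realType} {p1 p2 N : nat}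
  (X : 'I_N -> 'M[R]_(p1, p2)) (n : nat) : 'M[R]_(p1, p2) :=
  n%:R^-1 *: (\sum_(i < N | (i < n)%N) X i).
Definition mean_plus {R : realType} {p1 p2 N : nat}
  (X : 'I_N -> 'M[R]_(p1, p2)) (n : nat) : 'M[R]_(p1, p2) :=
  (N - n)%:R^-1 *: (\sum_(i < N | (n <= i)%N) X i).

Definition boot_cusum {R : realType} {p1 p2 N : nat}
  (e : 'I_N -> R) (X : 'I_N -> 'M[R]_(p1, p2)) (n : nat) : 'M[R]_(p1, p2) :=
  Num.sqrt (n%:R * (N - n)%:R / N%:R) *:
    ((N - n)%:R^-1 *: (\sum_(i < N | (n <= i)%N) e i *: (X i - mean_plus X n))
     - n%:R^-1 *: (\sum_(i < N | (i < n)%N) e i *: (X i - mean_minus X n))).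

Definition Tstat {R : realType} {p1 p2 N : nat} (mode nu : nat)
  (X : 'I_N -> 'M[R]_(p1, p2)) : R :=
  \big[Order.max/0]_(nu <= n < (N - nu).+1) norm_mode mode (cusum X n).

Definition Tboot {R : realType} {p1 p2 N : nat} (mode nu : nat)
  (e : 'I_N -> R) (X : 'I_N -> 'M[R]_(p1, p2)) : R :=
  \big[Order.max/0]_(nu <= n < (N - nu).+1) norm_mode mode (boot_cusum e X n).

Definition boot_quantile {R : realType} (B : nat) (Tb : 'I_B -> R) (alpha : R) : R :=
  inf [set t : R | 1 - alpha <= B%:R^-1 * \sum_(b < B) (((Tb b <= t)%R)%:R : R)].

(* v^T vec(A), with v written as a p1 x p2 array (vec is a bijection). *)
Definition lin {R : realType} {p1 p2 : nat} (v A : 'M[R]_(p1, p2)) : R :=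
  \sum_(j1 < p1) \sum_(j2 < p2) v j1 j2 * A j1 j2.

Definition sparse_unit {R : realType} {p1 p2 : nat} (v : 'M[R]_(p1, p2)) : Prop :=
  \sum_(j1 < p1) \sum_(j2 < p2) v j1 j2 ^+ 2 = 1 /\
  (#|[pred jk : 'I_p1 * 'I_p2 | v jk.1 jk.2 != 0%R]| <= maxn p1 p2)%N.

(* Mutual independence of groups of real random variables: the variables
   Z j, j : J, are grouped by g : J -> I; the groups (i.e. the random vectors
   (Z j)_{g j = i}, i : I) are mutually independent.  Stated on measurable
   rectangles, which form a generating pi-system of the product sigma-algebra
   (taking A j = setT covers all subfamilies). *)
Definition indep_groups {d} {T : measurableType d} {R : realType}
  (P : probability T R) (J I : finType) (g : J -> I) (Z : J -> T -> R) : Prop :=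
  forall A : J -> set R, (forall j, measurable (A j)) ->
    P (\bigcap_(j in [set: J]) (Z j @^-1` A j)) =
    (\prod_(i : I) fine (P (\bigcap_(j in [set j | g j = i]) (Z j @^-1` A j))))%:E.

Definition all_vars {T : Type} {R : realType} {p1 p2 N B : nat}
  (eps : 'I_N -> T -> 'M[R]_(p1, p2)) (e : 'I_B -> 'I_N -> T -> R)
  (j : ('I_N * 'I_p1 * 'I_p2) + ('I_B * 'I_N)) : T -> R :=
  match j with
  | inl x => fun w => eps x.1.1 w x.1.2 x.2
  | inr y => e y.1 y.2
  end.

Definition all_groups {p1 p2 N B : nat}
  (j : ('I_N * 'I_p1 * 'I_p2) + ('I_B * 'I_N)) : 'I_N + ('I_B * 'I_N) :=
  match j with
  | inl x => inl x.1.1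
  | inr y => inr y
  end.

(* Main.v *)
Require Import Defs.
From HB Require Import structures.
From mathcomp Require Import all_boot all_order all_algebra.
From mathcomp Require Import all_classical all_reals all_analysis.
From mathcomp Require Import measurable_realfun zify ring lra.
Set Implicit Arguments. Unset Strict Implicit. Unset Printing Implicit Defensive.
Import Order.TTheory GRing.Theory Num.Theory.
Import numFieldNormedType.Exports.
Local Open Scope classical_set_scope.
Local Open Scope ring_scope.

(* No Gaussian approximation is needed.  Let L = log (p N).  If eta_N >= 1/6 the
   bound is void; otherwise nu >= 16 L^5 and 1/(p N) <= eta_N, so an event of
   probability O(1/(p N)) may be discarded.  Outside such an event the truncated
   squares of the noise average to O(D_N^2) on every segment {i <= n}, {i > n}
   with nu <= n <= N - nu, and the entries of C_u(eps) are O(D_N sqrt L)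
   (Chernoff bounds for sub-exponential variables).  Then, conditionally on X,
   every entry of C^b_n(X) is a centred Gaussian of variance O(D_N^2), the shift
   delta_N contributing O(1) because its entries are at most 1; hence
   T^b exceeds t = 15 D_N sqrt s (sqrt L + sqrt (log (2 / alpha))) with
   conditional probability at most alpha / 8, and by a Chernoff bound at least
   alpha B of the B replicates do so with probability at most
   exp (- alpha^2 B / 2).  When neither happens the quantile is at most t, while
   T(X) >= |C_u(X)| >= t by the separation hypothesis. *)

(** The claim is one-sided, so only orders of magnitude matter: an upper bound for the bootstrap
    quantile and a lower bound for T(X) suffice, and the law of T(X) is never compared with that of
    T^b. Three obstacles shape the proof. Squares of sub-exponential variables need not have
    exponential moments; truncating them at (2 L)^2 allows a Chernoff bound with slope of order 1 /
    L^2, at the price of segments of length at least of order L^3. Independence is assumed on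
    rectangles of coordinates only, whereas the bootstrap step conditions on the whole array X; this
    is done by Tonelli's theorem between two sub-sigma-algebras. Finally, the residuals are centred
    at segment means which mix both regimes when n differs from u; since a mean minimizes the sum of
    squares, mu may replace it on both sides, and this is why delta costs only O(1). *)

(** * Markov's inequality, measurability of events, union bound *)

Section Probability.
Context {d : measure_display} {T : measurableType d} {R : realType}.
Variable P : probability T R.

(** Since f dominates the indicator of A. Every tail bound below comes from it, with f an
    exponential or a product dominating one. *)
Lemma le_probability_integral (A : set T) (f : T -> R) :
  measurable A -> measurable_fun setT f -> (forall w, 0 <= f w) ->
  (forall w, A w -> 1 <= f w) -> (P A <= \int[P]_w (f w)%:E)%E.
Proof.
move=> mA mf f0 f1; rewrite -(setIT A) -integral_indic//.
apply: ge0_le_integral => //.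
- exact/measurable_EFinP/measurable_indic.
- exact/measurable_EFinP.
- move=> w _; rewrite lee_fin indicE; case: (boolP (w \in A)) => // /set_mem.
  exact: f1.
Qed.

Lemma measurable_set_ler (f h : T -> R) :
  measurable_fun setT f -> measurable_fun setT h ->
  measurable [set w | f w <= h w].
Proof.
move=> mf mh; have := measurable_fun_ler mf mh.
by move=> /(_ measurableT [set true] Logic.I); rewrite setTI.
Qed.

Lemma measurable_exists (I : finType) (A : I -> set T) :
  (forall i, measurable (A i)) -> measurable [set w | exists i, A i w].
Proof.
move=> mA; rewrite (_ : [set w | _] = \bigcup_(i in [set: I]) A i).
  by apply: fin_bigcup_measurable => // ; exact: finite_finset.
by apply/seteqP; split=> [w [i Aw]|w [i _ Aw]]; exists i.
Qed.

Lemma union_bound (I : finType) (A : I -> set T) (q : R) :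
  (forall i, measurable (A i)) -> (forall i, (P (A i) <= q%:E)%E) ->
  (P [set w | exists i, A i w] <= (#|I|%:R * q)%:E)%E.
Proof.
move=> mA Aq; rewrite (_ : [set w | _] = \big[setU/set0]_(i <- index_enum I) A i); last first.
  rewrite -bigcup_seq; apply/seteqP; split=> [w [i Aw]|w [i _ Aw]]; last by exists i.
  by exists i => //=; rewrite mem_index_enum.
have -> : #|I| = size (index_enum I) by rewrite cardT enumT.
elim: (index_enum I) => [|i r IH]; first by rewrite big_nil measure0 mul0r.
rewrite big_cons -[size _]/((size r).+1) -natr1 mulrDl mul1r addrC EFinD.
apply: (@le_trans _ _ (P (A i) + P (\big[setU/set0]_(i <- r) A i))%E).
  by apply: measureU2 => //; exact: bigsetU_measurable.
exact: leeD.
Qed.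
End Probability.

(** * Tonelli's theorem for a pair of independent random elements *)

Section Fubini.
Context {d d1 d2 : measure_display} {T : measurableType d}.
Context {T1 : measurableType d1} {T2 : measurableType d2} {R : realType}.
Variables (P : probability T R) (U : {mfun T >-> T1}) (V : {mfun T >-> T2}).

(** Factorization on rectangles identifies the law of (U, V) with the product of the marginal laws,
    by uniqueness of product measures; Tonelli then replaces [V w] by an independent copy [V w']. *)
Lemma fubini_distribution (F : T1 * T2 -> \bar R) :
  (forall A B, measurable A -> measurable B ->
     P (U @^-1` A `&` V @^-1` B) = (P (U @^-1` A) * P (V @^-1` B))%E) ->
  measurable_fun setT F -> (forall x, 0 <= F x)%E ->
  (\int[P]_w F (U w, V w) = \int[P]_w \int[P]_w' F (U w, V w'))%E.
Proof.
move=> UV mF F0.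
have mUV : measurable_fun setT (fun w => (U w, V w)).
  by apply: measurable_fun_pair; exact: measurable_funPT.
transitivity (\int[pushforward P (fun w => (U w, V w))]_z F z)%E.
  by rewrite ge0_integral_pushforward.
transitivity (\int[distribution P U \x distribution P V]_z F z)%E.
  apply: eq_measure_integral => A mA _.
  exact/esym/(@product_measure_unique _ _ _ _ _ (distribution P U) (distribution P V)
    (pushforward P (fun w => (U w, V w))) UV A mA).
have -> := @fubini_tonelli1 _ _ _ _ _ (distribution P U) (distribution P V) F mF F0.
rewrite ge0_integral_distribution//.
- apply: eq_integral => w _ /=; rewrite /fubini_F ge0_integral_distribution//.
  by apply: measurableT_comp => //; exact: measurable_pair1.
- exact: measurable_fun_fubini_tonelli_F.
- by move=> x; exact: integral_ge0.
Qed.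

Lemma measurable_fubini_distribution (F : T1 * T2 -> \bar R) :
  measurable_fun setT F -> (forall x, 0 <= F x)%E ->
  measurable_fun setT (fun w => \int[P]_w' F (U w, V w'))%E.
Proof.
move=> mF F0; rewrite (_ : (fun _ => _) = fubini_F (distribution P V) F \o U).
  by apply: measurableT_comp => //; exact: measurable_fun_fubini_tonelli_F.
apply/funext => w /=; rewrite /fubini_F ge0_integral_distribution//.
by apply: measurableT_comp => //; exact: measurable_pair1.
Qed.

End Fubini.

(** * From independence on rectangles to conditioning on blocks and Chernoff bounds *)

Section Independence.
Context {d : measure_display} {T : measurableType d} {R : realType}.
Variables (P : probability T R) (J I : finType) (g : J -> I) (Z : J -> T -> R).
Hypothesis mZ : forall j, measurable_fun setT (Z j).
Hypothesis indZ : indep_groups P g Z.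

(** Rectangles that constrain only variables whose group lies in [K]: a pi-system generating the
    sigma-algebra of these groups. *)
Definition cylinders (K : pred I) : set (set T) :=
  [set C | exists A : J -> set R, [/\ forall j, measurable (A j),
     forall j, ~~ K (g j) -> A j = setT &
     C = \bigcap_(j in [set: J]) (Z j @^-1` A j)]].

Lemma measurable_preim_bigcap (S : set J) (A : J -> set R) :
  (forall j, measurable (A j)) -> measurable (\bigcap_(j in S) (Z j @^-1` A j)).
Proof.
move=> mA; apply: fin_bigcap_measurable => [|j _]; first exact: finite_finset.
by rewrite -[X in measurable X]setTI; apply: mZ.
Qed.

Lemma cylinders_setT K : cylinders K setT.
Proof.
exists (fun=> setT); split => //.
by apply/seteqP; split.
Qed.

Lemma cylinders_setI K : setI_closed (cylinders K).
Proof.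
move=> _ _ [A [mA KA ->]] [A' [mA' KA' ->]]; exists (fun j => A j `&` A' j).
split=> [j|j Kj|]; first exact: measurableI.
  by rewrite KA// KA'// setTI.
by rewrite -bigcapI.
Qed.

Lemma measurable_cylinders K C : cylinders K C -> measurable C.
Proof. by move=> [A [mA _ ->]]; exact: measurable_preim_bigcap. Qed.

(** Apply the product formula to [A], [A'] and their intersections and compare factor by factor:
    each group lies in at most one of [K1], [K2], so one of its two factors is the probability of
    [setT]. *)
Lemma cylinders_indep (K1 K2 : pred I) C1 C2 :
  (forall i, ~~ (K1 i && K2 i)) -> cylinders K1 C1 -> cylinders K2 C2 ->
  P (C1 `&` C2) = (P C1 * P C2)%E.
Proof.
move=> K12 [A [mA KA ->]] [A' [mA' KA' ->]].
rewrite -bigcapI.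
have := indZ mA; have := indZ mA' => -> ->.
have -> : \bigcap_(j in [set: J]) (Z j @^-1` A j `&` Z j @^-1` A' j) =
          \bigcap_(j in [set: J]) (Z j @^-1` (A j `&` A' j)) by [].
have := @indZ (fun j => A j `&` A' j) (fun j => measurableI _ _ (mA j) (mA' j)).
move=> ->.
rewrite -EFinM -big_split/=; congr EFin; apply: eq_bigr => i _.
have [K1i|K1i] := boolP (K1 i).
  have K2i : ~~ K2 i by have := K12 i; rewrite K1i.
  have E j : g j = i -> A' j = setT by move=> gj; apply: KA'; rewrite gj.
  have -> : \bigcap_(j in [set j | g j = i]) (Z j @^-1` A' j) = setT.
    by apply/seteqP; split => // x _ j /= gj; rewrite E.
  rewrite probability_setT/= mulr1; congr (fine (P _)).
  by apply: eq_bigcapr => j /= gj; rewrite E// setIT.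
have E j : g j = i -> A j = setT by move=> gj; apply: KA; rewrite gj.
have -> : \bigcap_(j in [set j | g j = i]) (Z j @^-1` A j) = setT.
  by apply/seteqP; split => // x _ j /= gj; rewrite E.
rewrite probability_setT/= mul1r; congr (fine (P _)).
by apply: eq_bigcapr => j /= gj; rewrite E// setTI.
Qed.

(* The same carrier [T] with the sub-sigma-algebra generated by the variables whose
   group lies in [K]: conditioning on a block of groups is then Tonelli's theorem
   for the image of [P] under the diagonal [w |-> (w, w)]. *)
Definition sub_space (K : pred I) : measurableType _ :=
  g_sigma_algebraType (cylinders K).
Local Notation TK := sub_space.

Lemma measurable_id_sub K : measurable_fun setT (fun w : T => w : TK K).
Proof.
move=> _ A mA; rewrite setTI preimage_id.
exact: (smallest_sub (@sigma_algebra_measurable _ T) (@measurable_cylinders K)).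
Qed.

Lemma measurable_coord_sub (K : pred I) j : K (g j) ->
  measurable_fun setT (Z j : TK K -> R).
Proof.
move=> Kj _ A mA; rewrite setTI; apply: sub_sigma_algebra.
exists (fun j' => if j' == j then A else setT); split=> [j'|j'|].
- by case: ifP.
- by case: eqP => // -> /negP.
- apply/seteqP; split => [x Ax j' _ /=|x /(_ j Logic.I)/=]; last by rewrite eqxx.
  by case: eqP => // ->.
Qed.


(** For fixed C0, the maps sending C to P (C [&] C0) and to P C * P C0 are finite measures that
    agree on a pi-system, hence on the sigma-algebra it generates. This is used once for each
    side. *)
Lemma sub_space_indep (K1 K2 : pred I) C1 C2 :
  (forall i, ~~ (K1 i && K2 i)) ->
  <<s cylinders K1 >> C1 -> <<s cylinders K2 >> C2 ->
  P (C1 `&` C2) = (P C1 * P C2)%E.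
Proof.
move=> K12.
have sub K C : <<s cylinders K >> C -> measurable C.
  exact: (smallest_sub (@sigma_algebra_measurable _ T) (@measurable_cylinders K)).
have step K C0 : measurable C0 ->
    (forall C, cylinders K C -> P (C `&` C0) = (P C * P C0)%E) ->
    forall C, <<s cylinders K >> C -> P (C `&` C0) = (P C * P C0)%E.
  move=> mC0 H C KC.
  have pC0 : 0 <= fine (P C0) by rewrite fine_ge0.
  have E D : (P D * P C0)%E = mscale (NngNum pC0) P D.
    by rewrite /mscale/= muleC fineK// fin_num_measure.
  rewrite E.
  apply: (@g_sigma_algebra_measure_unique _ _ _ (cylinders K) (@measurable_cylinders K)
    (fun=> setT) _ _ (mrestr P mC0) (mscale (NngNum pC0) P)) => //.
  - by move=> _; exact: cylinders_setT.
  - by rewrite bigcup_const.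
  - exact: cylinders_setI.
  - by move=> A /H; rewrite /mrestr E.
  - by move=> _ /=; rewrite /mrestr/= setTI -ge0_fin_numE// fin_num_measure.
move=> KC1 KC2; rewrite setIC muleC; move: C2 KC2; apply: (step) => [|C KC2].
  exact: sub KC1.
rewrite setIC muleC; move: C1 KC1; apply: (step) => [|C' KC1].
  exact: measurable_cylinders KC2.
exact: cylinders_indep KC1 KC2.
Qed.

Section TwoBlocks.
Variables (K1 K2 : pred I) (F : T -> T -> \bar R).
Hypothesis K12 : forall i, ~~ (K1 i && K2 i).
Hypothesis mF :
  @measurable_fun _ _ (TK K1 * TK K2)%type (\bar R) setT (fun z => F z.1 z.2).
Hypothesis F0 : forall x y, (0 <= F x y)%E.

Let U : {mfun T >-> TK K1} := HB.pack (fun w : T => w : TK K1)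
  (isMeasurableFun.Build _ _ _ _ _ (@measurable_id_sub K1)).
Let V : {mfun T >-> TK K2} := HB.pack (fun w : T => w : TK K2)
  (isMeasurableFun.Build _ _ _ _ _ (@measurable_id_sub K2)).

(** Hypothesis [mF] encodes that [F x y] depends on [x] only through the groups in [K1] and on [y]
    only through those in [K2]. *)
Lemma fubini_indep : (\int[P]_w F w w = \int[P]_w \int[P]_w' F w w')%E.
Proof.
apply: (@fubini_distribution _ _ _ _ _ _ _ P U V (fun z => F z.1 z.2)) => //.
move=> A B mA mB; exact: sub_space_indep K12 mA mB.
Qed.

Lemma fubini_indep_le (G : T -> \bar R) : measurable_fun setT G ->
  (forall w, \int[P]_w' F w w' <= G w)%E -> (\int[P]_w F w w <= \int[P]_w G w)%E.
Proof.
move=> mG FG; rewrite fubini_indep; apply: ge0_le_integral => //.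
- by move=> w _; exact: integral_ge0.
- exact: (@measurable_fubini_distribution _ _ _ _ _ _ _ P U V (fun z => F z.1 z.2)).
Qed.
End TwoBlocks.

(** Induction on [r]: the group of the head is one block, the groups of the tail are the other, and
    [uniq] makes them disjoint. *)
Lemma expectation_prod_le (K : eqType) (r : seq K) (js : K -> J)
    (f : K -> R -> R) (m : K -> R) :
  uniq [seq g (js k) | k <- r] ->
  (forall k, measurable_fun setT (f k)) -> (forall k x, 0 <= f k x) ->
  (forall k, k \in r -> (\int[P]_w (f k (Z (js k) w))%:E <= (m k)%:E)%E) ->
  (\int[P]_w (\prod_(k <- r) f k (Z (js k) w))%:E <= (\prod_(k <- r) m k)%:E)%E.
Proof.
move=> + mf f0; elim: r => [_ _|k r IH /= /andP[gk ur] fm].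
  under eq_integral do rewrite big_nil.
  by rewrite integral_cst// mul1e big_nil; exact: probability_le1.
under eq_integral do rewrite big_cons; rewrite big_cons.
have mprod (S : pred I) : (forall k', k' \in r -> S (g (js k'))) ->
    measurable_fun setT (fun w : TK S => \prod_(k' <- r) f k' (Z (js k') w)).
  move=> rS; apply: measurable_prod => k' k'r; apply: measurableT_comp => //.
  by apply: (@measurable_coord_sub S); exact: rS.
pose K1 := pred1 (g (js k)); pose K2 := mem [seq g (js k') | k' <- r].
rewrite (@fubini_indep K1 K2 (fun w w' => (f k (Z (js k) w) *
   \prod_(k' <- r) f k' (Z (js k') w'))%:E)).
- have mZk : measurable_fun setT (fun w => f k (Z (js k) w)) by exact: measurableT_comp.
  have mpr : measurable_fun setT (fun w => \prod_(k' <- r) f k' (Z (js k') w)).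
    by apply: measurable_prod => k' _ //; apply: measurableT_comp.
  have pr0 w : 0 <= \prod_(k' <- r) f k' (Z (js k') w) by exact: prodr_ge0.
  have H : (\int[P]_w (\prod_(k' <- r) f k' (Z (js k') w))%:E <=
            (\prod_(k' <- r) m k')%:E)%E.
    by apply: IH => // k' k'r; apply: fm; rewrite inE k'r orbT.
  under eq_integral => w _.
    under eq_integral do rewrite EFinM.
    rewrite ge0_integralZl//; first over.
    + exact/measurable_EFinP.
    + by move=> w' _; rewrite lee_fin.
    + by rewrite lee_fin.
  rewrite ge0_integralZr//.
  + rewrite EFinM; apply: lee_pmul => //.
    * by apply: integral_ge0 => w _; rewrite lee_fin.
    * by apply: integral_ge0 => w _; rewrite lee_fin.
    * by apply: fm; rewrite inE eqxx.
  + exact/measurable_EFinP.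
  + by move=> w _; rewrite lee_fin.
  + by apply: integral_ge0 => w _; rewrite lee_fin.
- by move=> i /=; apply: contra gk => /andP[/eqP <-].
- apply/measurable_EFinP; apply: measurable_funM.
    apply: measurableT_comp => //.
    apply: (@measurableT_comp _ _ _ _ _ _ (Z (js k) : TK K1 -> R)) => //.
    by apply: measurable_coord_sub => /=.
  apply: (@measurableT_comp _ _ _ _ _ _
    (fun w : TK K2 => \prod_(k' <- r) f k' (Z (js k') w))) => //.
  by apply: mprod => k' k'r; exact: (map_f (fun k => g (js k))).
- by move=> w w'; rewrite lee_fin mulr_ge0// prodr_ge0.
Qed.

(** Exponential Markov inequality with the slope already absorbed in [h] and [t]. Injectivity of
    [g \o js] puts the summands in distinct groups, so the exponential moment factorizes. *)
Lemma chernoff_indep (K : finType) (S : pred K) (js : K -> J) (h : K -> R -> R)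
    (m : K -> R) (t : R) :
  injective (g \o js) -> (forall k, measurable_fun setT (h k)) ->
  (forall k, (\int[P]_w (expR (h k (Z (js k) w)))%:E <= (expR (m k))%:E)%E) ->
  (P [set w | (t <= \sum_(k | S k) h k (Z (js k) w))%R] <=
     (expR (\sum_(k | S k) m k - t))%:E)%E.
Proof.
move=> inj mh hm; pose r := [seq k <- index_enum K | S k].
have sumr (F : K -> R) : \sum_(k | S k) F k = \sum_(k <- r) F k by rewrite big_filter.
under eq_set do rewrite sumr; rewrite sumr.
have mS : measurable_fun setT (fun w => \sum_(k <- r) h k (Z (js k) w)).
  by apply: measurable_sum => j; apply: measurableT_comp.
apply: (@le_trans _ _ (\int[P]_w (expR (\sum_(k <- r) h k (Z (js k) w)) * expR (- t))%:E)%E).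
  apply: le_probability_integral.
  - exact: measurable_set_ler.
  - by apply: measurable_funM => //; exact: measurableT_comp.
  - by move=> w; rewrite mulr_ge0// expR_ge0.
  - by move=> w /= tS; rewrite -expRD -expR0 ler_expR subr_ge0.
under eq_integral do rewrite EFinM expR_sum.
rewrite ge0_integralZr//.
- rewrite expRD EFinM lee_wpmul2r// ?lee_fin ?expR_ge0// expR_sum.
  apply: (@expectation_prod_le _ r js (fun k x => expR (h k x)) (fun k => expR (m k))) => //.
  + by rewrite (map_inj_uniq inj) filter_uniq// index_enum_uniq.
  + by move=> k; exact: measurableT_comp.
- apply/measurable_EFinP; apply: measurable_prod => k _.
  by do 2 apply: measurableT_comp => //.
- by move=> w _; rewrite lee_fin prodr_ge0// => k _; exact: expR_ge0.
Qed.
End Independence.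

(** * Elementary inequalities for the exponential *)

Section ExpBounds.
Context {R : realType}.
Implicit Types x y : R.

Lemma expR_le_quadratic y : expR y <= 1 + y + y ^+ 2 * expR `|y|.
Proof.
(* [exp z - 1 <= z exp z], applied twice *)
have dec (z : R) : expR z - 1 <= z * expR z.
  have := expR_ge1Dx (- z); rewrite expRN => h.
  have := ler_wpM2r (expR_ge0 z) h; rewrite mulVf ?expR_eq0//; lra.
have [y0|y0] := leP 0 y.
  rewrite ger0_norm//; have := dec y; have := expR_ge0 y; nra.
rewrite ltr0_norm//; have h1 := expR_ge1Dx y.
have h2 : 1 <= expR (- y) by rewrite -expR0 ler_expR; lra.
have := dec y; nra.
Qed.

Lemma expR_le_linear y : 0 <= y <= 2^-1 -> expR y <= 1 + 2 * y.
Proof.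
move=> y01; have := expR_ge1Dx (- y); rewrite expRN => h.
have := ler_wpM2r (expR_ge0 y) h; rewrite mulVf ?expR_eq0//.
have := expR_gt0 y; nra.
Qed.

Lemma expR1_le4 : expR (1 : R) <= 4.
Proof.
have h : expR (2^-1 : R) <= 2.
  by apply: (le_trans (expR_le_linear _)); [rewrite lexx andbT invr_ge0|lra].
have -> : expR (1 : R) = expR 2^-1 * expR 2^-1 by rewrite [in LHS](splitr 1) mul1r expRD.
by have := expR_gt0 (2^-1 : R); nra.
Qed.

Lemma sqr_le_expR y : 0 <= y -> y ^+ 2 <= 2 * expR y.
Proof. by move=> y0; have := expR_ge1Dxn 1 y0; rewrite (_ : 2`! = 2)%N // => h; lra. Qed.

(** Absorbs the remainder of [expR_le_quadratic] into the one exponential moment that is available.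
    Half of the exponent pays for the square, hence the restriction to slopes at most 1/2 in
    [subexp_mgf]. *)
Lemma sqr_mul_expR_le y : y ^+ 2 * expR (`|y| / 2) <= 8 * expR `|y|.
Proof.
have h : (`|y| / 2) ^+ 2 <= 2 * expR (`|y| / 2) by apply: sqr_le_expR; rewrite divr_ge0.
have -> : expR `|y| = expR (`|y| / 2) * expR (`|y| / 2).
  by rewrite -expRD -splitr.
have := expR_ge0 (`|y| / 2); rewrite exprMn real_normK ?num_real// in h; nra.
Qed.
End ExpBounds.

(** * Tail and moment generating functions of a sub-exponential variable *)

Section Moments.
Context {d : measure_display} {T : measurableType d} {R : realType}.
Variables (P : probability T R) (Y : T -> R) (D : R).
Hypotheses (mY : measurable_fun setT Y) (D1 : 1 <= D)
  (Yexp : (\int[P]_w (expR (`|Y w| / D))%:E <= 2%:E)%E).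

Let integral1 : (\int[P]_w 1%:E = 1%:E)%E.
Proof. by rewrite integral_cst// mul1e; exact: probability_setT. Qed.

Let D0 : 0 < D. Proof. exact: lt_le_trans D1. Qed.

Let mexp (a : R) : measurable_fun setT (fun w => expR (a * (`|Y w| / D))).
Proof.
apply: measurableT_comp => //; apply: measurable_funM => //.
by apply: measurable_funM => //; exact: measurableT_comp.
Qed.

Lemma subexp_tail (t : R) :
  (P [set w | (t <= `|Y w| / D)%R] <= (2 * expR (- t))%:E)%E.
Proof.
have mE : measurable_fun setT (fun w => expR (`|Y w| / D)).
  by have := mexp 1; under eq_fun do rewrite mul1r.
apply: (@le_trans _ _ (\int[P]_w (expR (`|Y w| / D) * expR (- t))%:E)%E).
  apply: le_probability_integral.
  - apply: measurable_set_ler => //; apply: measurable_funM => //.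
    exact: measurableT_comp.
  - exact: measurable_funM.
  - by move=> w; rewrite mulr_ge0// expR_ge0.
  - by move=> w /= tS; rewrite -expRD -expR0 ler_expR subr_ge0.
under eq_integral do rewrite EFinM.
rewrite ge0_integralZr ?lee_fin ?expR_ge0//.
- by rewrite EFinM lee_wpmul2r// lee_fin expR_ge0.
- exact/measurable_EFinP.
Qed.

(** With z = Y / D, exp (x z) <= 1 + x z + 8 x^2 exp |z|. The linear term has mean zero and the last
    one has mean at most 16 x^2. *)
Lemma subexp_mgf (x : R) : P.-integrable setT (EFin \o Y) ->
  (\int[P]_w (Y w)%:E = 0)%E -> `|x| <= 2^-1 ->
  (\int[P]_w (expR (x / D * Y w))%:E <= (expR (16 * x ^+ 2))%:E)%E.
Proof.
move=> iY Y0 x2.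
have mE : measurable_fun setT (fun w => expR (`|Y w| / D)).
  by have := mexp 1; under eq_fun do rewrite mul1r.
have iE : P.-integrable setT (fun w => (expR (`|Y w| / D))%:E).
  apply/integrableP; split; first exact/measurable_EFinP.
  under eq_integral do rewrite gee0_abs ?lee_fin ?expR_ge0//.
  by apply: le_lt_trans Yexp _; rewrite ltry.
have i1 : P.-integrable setT (fun w => 1%:E : \bar R).
  exact: (finite_measure_integrable_cst P 1).
have iL : P.-integrable setT (fun w => (x / D)%:E * (Y w)%:E)%E by exact: integrableZl.
have iQ : P.-integrable setT (fun w => (8 * x ^+ 2)%:E * (expR (`|Y w| / D))%:E)%E.
  exact: integrableZl.
apply: (@le_trans _ _ (\int[P]_w (1%:E + ((x / D)%:E * (Y w)%:E +
   (8 * x ^+ 2)%:E * (expR (`|Y w| / D))%:E)))%E).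
  apply: ge0_le_integral => //.
  - by apply/measurable_EFinP/measurableT_comp => //; exact: measurable_funM.
  - have := integrableD measurableT i1 (integrableD measurableT iL iQ).
    exact: measurable_int.
  - move=> w _; rewrite -!EFinM -!EFinD lee_fin.
    have := expR_le_quadratic (x / D * Y w).
    set z := Y w / D; have -> : x / D * Y w = x * z by rewrite /z; ring.
    have -> : `|Y w| / D = `|z| by rewrite /z normrM normfV (gtr0_norm D0).
    have h := sqr_mul_expR_le z.
    have h2 : expR `|x * z| <= expR (`|z| / 2).
      by rewrite ler_expR normrM mulrC ler_wpM2l.
    have := ler_wpM2l (sqr_ge0 (x * z)) h2.
    have := ler_wpM2l (sqr_ge0 x) h.
    rewrite !exprMn; lra.
rewrite integralD//; last exact: integrableD.
rewrite integralD// !integralZl// Y0 mule0 add0e integral1.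
apply: (@le_trans _ _ (1%:E + (8 * x ^+ 2)%:E * 2%:E)%E).
  by rewrite leeD2l// lee_wpmul2l// lee_fin mulr_ge0// sqr_ge0.
rewrite -EFinM -EFinD lee_fin.
by apply: le_trans (expR_ge1Dx _); lra.
Qed.

(** Truncation keeps the exponent in [0, 1/2], where exp y <= 1 + 2 y; combined with z^2 <= 2 exp
    |z| this gives 1 + 4 l exp |z|, of mean at most 1 + 8 l. *)
Lemma subexp_trunc_sqr_mgf (l M : R) : 0 <= l -> l * M <= 2^-1 -> 0 <= M ->
  (\int[P]_w (expR (l * Num.min ((Y w / D) ^+ 2) M))%:E <= (expR (8 * l))%:E)%E.
Proof.
move=> l0 lM M0.
have mE : measurable_fun setT (fun w => expR (`|Y w| / D)).
  by have := mexp 1; under eq_fun do rewrite mul1r.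
apply: (@le_trans _ _ (\int[P]_w (1%:E + (4 * l)%:E * (expR (`|Y w| / D))%:E))%E).
  apply: ge0_le_integral => //.
  - apply/measurable_EFinP/measurableT_comp => //; apply: measurable_funM => //.
    apply: measurable_minr => //; apply: measurable_funX.
    exact: measurable_funM.
  - apply: emeasurable_funD => //; apply: emeasurable_funM => //.
    exact/measurable_EFinP.
  - move=> w _; rewrite -!EFinM -!EFinD lee_fin.
    set z := Y w / D; have -> : `|Y w| / D = `|z| by rewrite /z normrM normfV (gtr0_norm D0).
    have h := sqr_le_expR (normr_ge0 z); rewrite real_normK ?num_real// in h.
    have m1 : Num.min (z ^+ 2) M <= z ^+ 2 by rewrite ge_min lexx.
    have m2 : Num.min (z ^+ 2) M <= M by rewrite ge_min lexx orbT.
    have m0 : 0 <= Num.min (z ^+ 2) M by rewrite le_min sqr_ge0.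
    have y01 : 0 <= l * Num.min (z ^+ 2) M <= 2^-1.
      rewrite mulr_ge0//=; apply: le_trans lM; exact: ler_wpM2l.
    have := expR_le_linear y01.
    have := ler_wpM2l l0 (le_trans m1 h); lra.
rewrite ge0_integralD//; last 2 first.
- by move=> w _; rewrite mule_ge0// lee_fin ?expR_ge0// mulr_ge0.
- apply: emeasurable_funM => //; exact/measurable_EFinP.
rewrite integral1 ge0_integralZl//; [|exact/measurable_EFinP|by rewrite lee_fin mulr_ge0].
apply: (@le_trans _ _ (1%:E + (4 * l)%:E * 2%:E)%E).
  by rewrite leeD2l// lee_wpmul2l// lee_fin mulr_ge0.
rewrite -EFinM -EFinD lee_fin.
by apply: le_trans (expR_ge1Dx _); lra.
Qed.

End Moments.

(** * Moment generating function of the standard normal law *)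

Section Gaussian.
Context {R : realType}.
Local Notation mu := (@lebesgue_measure R).

(** Change of variables yields the abstract Radon-Nikodym derivative; it agrees almost everywhere
    with the density because both have the same integral over every measurable set. *)
Lemma integral_normal_prob (m s : R) (f : R -> \bar R) :
  measurable_fun setT f -> (forall x, 0 <= f x)%E ->
  (\int[normal_prob m s]_x f x = \int[mu]_x (f x * (normal_pdf m s x)%:E))%E.
Proof.
move=> mf f0; have dom := normal_prob_dominates m s.
rewrite -(Radon_Nikodym_SigmaFinite.change_of_variables dom)//.
have mpdf : measurable_fun setT (fun x => (normal_pdf m s x)%:E).
  by apply/measurable_EFinP; exact: measurable_normal_pdf.
have iRN := Radon_Nikodym_SigmaFinite.f_integrable dom.
apply: ae_eq_integral => //.
- by apply: emeasurable_funM => //; exact: measurable_int iRN.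
- exact: emeasurable_funM.
- apply: ae_eqe_mul2l; apply: integral_ae_eq => // A _ mA.
  by rewrite -Radon_Nikodym_SigmaFinite.f_integral.
Qed.

Lemma normal_prob_mgf (c : R) :
  (\int[normal_prob 0 1]_x (expR (c * x))%:E = (expR (c ^+ 2 / 2))%:E)%E.
Proof.
rewrite integral_normal_prob; last 2 first.
- by apply/measurable_EFinP/measurableT_comp => //; exact: measurable_funM.
- by move=> x; rewrite lee_fin expR_ge0.
(* Completing the square: exp (c x) tilts the standard density into the one with mean c. *)
transitivity (\int[mu]_x ((expR (c ^+ 2 / 2))%:E * (normal_pdf c 1 x)%:E))%E.
  apply: eq_integral => x _; rewrite -!EFinM !normal_pdfE ?oner_eq0//; congr EFin.
  rewrite mulrCA [RHS]mulrCA; congr (_ * _).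
  by rewrite /normal_fun -!expRD; congr expR; field.
rewrite ge0_integralZl ?integral_normal_pdf ?mule1//.
- by apply/measurable_EFinP; exact: measurable_normal_pdf.
- by move=> x _; rewrite lee_fin normal_pdf_ge0.
Qed.



Lemma gaussian_mgf {d} {T : measurableType d} (P : probability T R) (Y : T -> R)
  (c : R) : measurable_fun setT Y ->
  (forall A : set R, measurable A -> P (Y @^-1` A) = normal_prob 0 1 A) ->
  (\int[P]_w (expR (c * Y w))%:E = (expR (c ^+ 2 / 2))%:E)%E.
Proof.
move=> mY PY; rewrite -normal_prob_mgf.
have mf : measurable_fun setT (fun x : R => (expR (c * x))%:E).
  by apply/measurable_EFinP/measurableT_comp => //; exact: measurable_funM.
pose YR : T -> measurableTypeR R := Y.
have mYR : measurable_fun setT YR by [].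
transitivity (\int[pushforward P YR]_x (expR (c * x))%:E)%E.
  by rewrite ge0_integral_pushforward// => x _; rewrite lee_fin expR_ge0.
pose PY' : {measure set (measurableTypeR R) -> \bar R} := pushforward P YR.
by apply: (@eq_measure_integral _ _ _ setT (normal_prob 0 1) (PY' mYR)) => A mA _; exact: PY.
Qed.

End Gaussian.

(** * Bounds for the mode norms *)

Section Norms.
Context {R : realType}.

Lemma norm22_tr {p1 p2 : nat} (A : 'M[R]_(p1, p2)) : norm22 A = norm12 A^T.
Proof. by apply: eq_bigr => j _; congr Num.sqrt; apply: eq_bigr => k _; rewrite mxE. Qed.

Lemma norm12_le {p1 p2 : nat} (A : 'M[R]_(p1, p2)) (m : R) :
  0 <= m -> (forall j k, `|A j k| <= m) -> norm12 A <= Num.sqrt p2%:R * m.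
Proof.
move=> m0 Am; apply: bigmax_le => [|j _]; first by rewrite mulr_ge0// sqrtr_ge0.
have -> : Num.sqrt p2%:R * m = Num.sqrt (p2%:R * m ^+ 2).
  by rewrite sqrtrM// sqrtr_sqr ger0_norm.
rewrite ler_sqrt ?mulr_ge0// ?sqr_ge0//.
apply: (@le_trans _ _ (\sum_(k < p2) m ^+ 2)).
  by apply: ler_sum => k _; rewrite -(real_normK (num_real (A j k))) lerXn2r ?nnegrE.
by rewrite sumr_const card_ord mulr_natl.
Qed.

Lemma norm12_ge0 {p1 p2 : nat} (A : 'M[R]_(p1, p2)) : 0 <= norm12 A.
Proof. exact: bigmax_ge_id. Qed.

(** On the row where [A] attains its norm, use (g a + e)^2 >= (g a)^2 / 2 - e^2, which is (g a + 2
    e)^2 >= 0. Working with squares avoids a triangle inequality for the norm. *)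
Lemma norm12_lower {p1 p2 : nat} (A E : 'M[R]_(p1, p2)) (g m : R) :
  (0 < p1)%N -> (forall j k, `|E j k| <= m) ->
  (g * norm12 A) ^+ 2 / 2 - p2%:R * m ^+ 2 <= norm12 (g *: A + E) ^+ 2.
Proof.
move=> p1_gt0 Em.
have [|j _ nA] := @eq_bigmax _ R 'I_p1 0 (Ordinal p1_gt0) predT
  (fun j => Num.sqrt (\sum_(k < p2) A j k ^+ 2)) isT.
  by move=> i _; exact: sqrtr_ge0.
have {}nA : norm12 A = Num.sqrt (\sum_(k < p2) A j k ^+ 2) by [].
rewrite nA.
set S := \sum_(k < p2) (g *: A + E) j k ^+ 2.
have S0 : 0 <= S by apply: sumr_ge0 => k _; exact: sqr_ge0.
have : Num.sqrt S <= norm12 (g *: A + E).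
  exact: (@le_bigmax _ R 'I_p1 0 (fun j => Num.sqrt (\sum_(k < p2) (g *: A + E) j k ^+ 2)) j).
rewrite -(@ler_pXn2r _ 2%N)// ?nnegrE ?sqrtr_ge0 ?norm12_ge0// sqr_sqrtr//.
apply: le_trans; rewrite exprMn sqr_sqrtr; last first.
  by apply: sumr_ge0 => k _; exact: sqr_ge0.
have -> : p2%:R * m ^+ 2 = \sum_(k < p2) m ^+ 2 by rewrite sumr_const card_ord mulr_natl.
rewrite mulr_sumr mulr_suml -sumrB; apply: ler_sum => k _; rewrite !mxE.
have m0 : 0 <= m by exact: le_trans (normr_ge0 _) (Em j k).
have h : E j k ^+ 2 <= m ^+ 2.
  by rewrite -(real_normK (num_real (E j k))) lerXn2r ?nnegrE.
have := sqr_ge0 (g * A j k + 2 * E j k); nra.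
Qed.

Definition mode_size (mode p1 p2 : nat) := if mode == 1%N then p2 else p1.

Lemma norm_mode_le {p1 p2 : nat} mode (A : 'M[R]_(p1, p2)) (m : R) :
  0 <= m -> (forall j k, `|A j k| <= m) ->
  norm_mode mode A <= Num.sqrt (mode_size mode p1 p2)%:R * m.
Proof.
move=> m0 Am; rewrite /norm_mode /mode_size; case: ifP => _; first exact: norm12_le.
by rewrite norm22_tr; apply: norm12_le => // j k; rewrite mxE.
Qed.

Lemma norm_mode_ge0 {p1 p2 : nat} mode (A : 'M[R]_(p1, p2)) : 0 <= norm_mode mode A.
Proof. by rewrite /norm_mode; case: ifP => _; exact: bigmax_ge_id. Qed.

Lemma norm_mode_lower {p1 p2 : nat} mode (A E : 'M[R]_(p1, p2)) (g m : R) :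
  (0 < p1)%N -> (0 < p2)%N -> (forall j k, `|E j k| <= m) ->
  (g * norm_mode mode A) ^+ 2 / 2 - (mode_size mode p1 p2)%:R * m ^+ 2
    <= norm_mode mode (g *: A + E) ^+ 2.
Proof.
move=> p10 p20 Em; rewrite /norm_mode /mode_size; case: ifP => _.
  exact: norm12_lower.
rewrite !norm22_tr.
have -> : (g *: A + E)^T = g *: A^T + E^T by apply/matrixP => j k; rewrite !mxE.
by apply: norm12_lower => // j k; rewrite mxE.
Qed.
End Norms.

(** * The CUSUM weights and their sums of squares *)

Section Weights.
Context {R : realType} {N : nat}.
Implicit Types (x e : 'I_N -> R) (n : nat).

Lemma sum_const_lo n (a : R) : (n <= N)%N ->
  \sum_(i < N | (i < n)%N) a = n%:R * a.
Proof.
by move=> nN; rewrite -(big_ord_widen N (fun=> a) nN) sumr_const card_ord mulr_natl.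
Qed.

Lemma sum_const_hi n (a : R) : (n <= N)%N ->
  \sum_(i < N | (n <= i)%N) a = (N - n)%:R * a.
Proof.
move=> nN; have : \sum_(i < N) a = N%:R * a by rewrite sumr_const card_ord mulr_natl.
rewrite (bigID (fun i : 'I_N => (i < n)%N))/= sum_const_lo// natrB// mulrBl => <-.
by rewrite addrC addrK; apply: eq_bigl => i; rewrite -leqNgt.
Qed.

Lemma sum_split n (F : 'I_N -> R) : \sum_(i < N) F i =
  \sum_(i < N | (n <= i)%N) F i + \sum_(i < N | (i < n)%N) F i.
Proof.
rewrite (bigID (fun i : 'I_N => (n <= i)%N))/=; congr (_ + _).
by apply: eq_bigl => i; rewrite -ltnNge.
Qed.

(** Coefficient of the i-th observation in the CUSUM at n; it turns the CUSUM into one linear form,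
    to which a Chernoff bound applies directly. *)
Definition cusum_weight n (i : 'I_N) : R :=
  Num.sqrt (n%:R * (N - n)%:R / N%:R) * (if (n <= i)%N then (N - n)%:R^-1 else - n%:R^-1).

Lemma sum_cusum_weight n x : \sum_(i < N) cusum_weight n i * x i =
  Num.sqrt (n%:R * (N - n)%:R / N%:R) *
  ((N - n)%:R^-1 * (\sum_(i < N | (n <= i)%N) x i) -
   n%:R^-1 * (\sum_(i < N | (i < n)%N) x i)).
Proof.
rewrite (sum_split n) mulrBr !mulr_sumr; congr (_ + _).
  by apply: eq_bigr => i ni; rewrite /cusum_weight ni mulrA.
rewrite -sumrN; apply: eq_bigr => i ni.
by rewrite /cusum_weight leqNgt ni/=; ring.
Qed.

(** The squared weights are n / ((N - n) N) on the right and (N - n) / (n N) on the left, so the two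
    sides contribute at most n v / N and (N - n) v / N. *)
Lemma cusum_weight_sqr_le n v x : (0 < n < N)%N ->
  \sum_(i < N | (n <= i)%N) x i ^+ 2 <= (N - n)%:R * v ->
  \sum_(i < N | (i < n)%N) x i ^+ 2 <= n%:R * v ->
  \sum_(i < N) (cusum_weight n i * x i) ^+ 2 <= v.
Proof.
move=> /andP[n0 nN] hi lo.
have n0' : 0 < n%:R :> R by rewrite ltr0n.
have m0 : 0 < (N - n)%:R :> R by rewrite ltr0n subn_gt0.
have NE : N%:R = n%:R + (N - n)%:R :> R by rewrite -natrD subnKC// ltnW.
have G2 : Num.sqrt (n%:R * (N - n)%:R / N%:R) ^+ 2 = n%:R * (N - n)%:R / N%:R :> R.
  by rewrite sqr_sqrtr// !mulr_ge0 ?invr_ge0.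
rewrite (sum_split n).
have -> : \sum_(i < N | (n <= i)%N) (cusum_weight n i * x i) ^+ 2 =
    n%:R / (N - n)%:R / N%:R * \sum_(i < N | (n <= i)%N) x i ^+ 2.
  rewrite mulr_sumr; apply: eq_bigr => i ni.
  rewrite /cusum_weight ni !exprMn G2 NE; field.
  by rewrite -NE !gt_eqF// NE addr_gt0.
have -> : \sum_(i < N | (i < n)%N) (cusum_weight n i * x i) ^+ 2 =
    (N - n)%:R / n%:R / N%:R * \sum_(i < N | (i < n)%N) x i ^+ 2.
  rewrite mulr_sumr; apply: eq_bigr => i ni.
  rewrite /cusum_weight leqNgt ni/= !exprMn G2 NE; field.
  by rewrite -NE !gt_eqF// NE addr_gt0.
have -> : v = n%:R / (N - n)%:R / N%:R * ((N - n)%:R * v) +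
   (N - n)%:R / n%:R / N%:R * (n%:R * v).
  by rewrite NE; field; rewrite -NE !gt_eqF// NE addr_gt0.
by apply: lerD; apply: ler_wpM2l => //; rewrite !mulr_ge0 ?invr_ge0.
Qed.

Lemma cusum_weight_sqr_sum n : (0 < n < N)%N -> \sum_(i < N) cusum_weight n i ^+ 2 <= 1.
Proof.
move=> nN; under eq_bigr do rewrite -[cusum_weight n _]mulr1.
have nN' : (n <= N)%N by case/andP: nN => _ /ltnW.
apply: (cusum_weight_sqr_le nN); first by rewrite sum_const_hi// expr1n.
by rewrite sum_const_lo// expr1n.
Qed.

(** Each squared weight is at most 1 / (N - n) or 1 / n. This is what keeps the Chernoff slope of
    [noise_cusum] within the range of [subexp_mgf]. *)
Lemma cusum_weight_le nu n i : (0 < nu)%N -> (nu <= n)%N -> (n <= N - nu)%N ->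
  (n < N)%N -> cusum_weight n i ^+ 2 <= nu%:R^-1.
Proof.
move=> nu0 nun nN nN'.
have n0' : 0 < n%:R :> R by rewrite ltr0n (leq_trans nu0).
have m0 : 0 < (N - n)%:R :> R by rewrite ltr0n subn_gt0.
have NE : N%:R = n%:R + (N - n)%:R :> R by rewrite -natrD subnKC// ltnW.
have N0 : 0 < N%:R :> R by rewrite NE addr_gt0.
have G2 : Num.sqrt (n%:R * (N - n)%:R / N%:R) ^+ 2 = n%:R * (N - n)%:R / N%:R :> R.
  by rewrite sqr_sqrtr// !mulr_ge0 ?invr_ge0.
have nu0' : 0 < nu%:R :> R by rewrite ltr0n.
rewrite /cusum_weight exprMn G2; case: ifP => ni.
  have -> : n%:R * (N - n)%:R / N%:R * (N - n)%:R^-1 ^+ 2 = n%:R / N%:R * (N - n)%:R^-1 :> R.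
    by field; rewrite !gt_eqF.
  apply: (@le_trans _ _ (1 * (N - n)%:R^-1)).
    apply: ler_wpM2r; first by rewrite invr_ge0.
    by rewrite ler_pdivrMr// mul1r ler_nat ltnW.
  rewrite mul1r lef_pV2 ?posrE// ler_nat; lia.
have -> : n%:R * (N - n)%:R / N%:R * (- n%:R^-1) ^+ 2 = (N - n)%:R / N%:R * n%:R^-1 :> R.
  by field; rewrite !gt_eqF.
apply: (@le_trans _ _ (1 * n%:R^-1)).
  apply: ler_wpM2r; first by rewrite invr_ge0.
  by rewrite ler_pdivrMr// mul1r ler_nat leq_subr.
by rewrite mul1r lef_pV2 ?posrE// ler_nat.
Qed.

(** The difference is q (m - c)^2. It exchanges a random segment mean for any fixed centre. *)
Lemma sum_sqr_mean_le (S : pred 'I_N) x (m q c : R) : 0 < q ->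
  \sum_(i | S i) 1 = q -> m = q^-1 * \sum_(i | S i) x i ->
  \sum_(i | S i) (x i - m) ^+ 2 <= \sum_(i | S i) (x i - c) ^+ 2.
Proof.
move=> q0 Sq mE.
have xs : \sum_(i | S i) x i = q * m by rewrite mE mulrA divff ?mul1r// gt_eqF.
rewrite -subr_ge0 -sumrB.
have -> : \sum_(i | S i) ((x i - c) ^+ 2 - (x i - m) ^+ 2) =
    2 * (m - c) * (\sum_(i | S i) x i) + (c ^+ 2 - m ^+ 2) * \sum_(i | S i) 1.
  by rewrite !mulr_sumr -big_split/=; apply: eq_bigr => i _; ring.
rewrite xs Sq.
have -> : 2 * (m - c) * (q * m) + (c ^+ 2 - m ^+ 2) * q = q * (m - c) ^+ 2 by ring.
by rewrite mulr_ge0// ?sqr_ge0// ltW.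
Qed.

End Weights.

(** * CUSUM and bootstrap CUSUM as linear forms *)

Section Cusum.
Context {R : realType} {p1 p2 N : nat}.
Implicit Types (X : 'I_N -> 'M[R]_(p1, p2)).

Lemma cusum_entry X n j k : cusum X n j k = \sum_(i < N) cusum_weight n i * X i j k.
Proof. by rewrite sum_cusum_weight !mxE !summxE. Qed.

Definition segment_mean X n (i : 'I_N) : 'M[R]_(p1, p2) :=
  if (n <= i)%N then mean_plus X n else mean_minus X n.

(** Coefficient of the multiplier [e i]; given the data, the sum of squares of these is the variance
    of the bootstrap entry. *)
Definition boot_weight X n j k (i : 'I_N) : R :=
  cusum_weight n i * (X i j k - segment_mean X n i j k).

Lemma boot_cusum_entry e X n j k :
  boot_cusum e X n j k = \sum_(i < N) boot_weight X n j k i * e i.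
Proof.
have -> : \sum_(i < N) boot_weight X n j k i * e i = \sum_(i < N)
    cusum_weight n i * (e i * (X i j k - segment_mean X n i j k)).
  by apply: eq_bigr => i _; rewrite /boot_weight; ring.
rewrite sum_cusum_weight !mxE !summxE; congr (_ * (_ * _ - _ * _)).
  by apply: eq_bigr => i ni; rewrite /segment_mean ni !mxE.
by apply: eq_bigr => i ni; rewrite /segment_mean leqNgt ni !mxE.
Qed.

Lemma boot_weight_sqr_sum X n j k (v : R) (c : bool -> R) : (0 < n < N)%N ->
  \sum_(i < N | (n <= i)%N) (X i j k - c true) ^+ 2 <= (N - n)%:R * v ->
  \sum_(i < N | (i < n)%N) (X i j k - c false) ^+ 2 <= n%:R * v ->
  \sum_(i < N) boot_weight X n j k i ^+ 2 <= v.
Proof.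
move=> nN hi lo; have /andP[n0 nN'] := nN.
apply: (cusum_weight_sqr_le nN).
- under eq_bigr => i ni do rewrite /segment_mean ni.
  apply: le_trans hi; apply: (@sum_sqr_mean_le _ _ _ _ _ (N - n)%:R).
  + by rewrite ltr0n subn_gt0.
  + by rewrite sum_const_hi ?mulr1// ltnW.
  + by rewrite !mxE summxE.
- under eq_bigr => i ni do rewrite /segment_mean leqNgt ni.
  apply: le_trans lo; apply: (@sum_sqr_mean_le _ _ _ _ _ n%:R).
  + by rewrite ltr0n.
  + by rewrite sum_const_lo ?mulr1// ltnW.
  + by rewrite !mxE summxE.
Qed.

(** The weights sum to zero, which cancels [mu], and at the true change point [delta] fills exactly
    the right segment. *)
Lemma cusum_shift (mu delta : 'M[R]_(p1, p2)) (eps : 'I_N -> 'M[R]_(p1, p2)) u :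
  (0 < u < N)%N ->
  cusum (fun i => mu + (if (u <= i)%N then delta else 0) + eps i) u =
  Num.sqrt (u%:R * (N - u)%:R / N%:R) *: delta + cusum eps u.
Proof.
move=> /andP[u0 uN]; apply/matrixP => j k; rewrite cusum_entry [RHS]mxE cusum_entry.
have -> : \sum_(i < N) cusum_weight u i *
     (mu + (if (u <= i)%N then delta else 0) + eps i) j k =
   \sum_(i < N) cusum_weight u i * (mu j k + if (u <= i)%N then delta j k else 0) +
   \sum_(i < N) cusum_weight u i * eps i j k.
  rewrite -big_split/=; apply: eq_bigr => i _; rewrite -mulrDr !mxE.
  by case: ifP => _; rewrite ?mxE.
congr (_ + _); rewrite sum_cusum_weight mxE; congr (_ * _).
under eq_bigr => i ui do rewrite ui.
under [X in _ - _ * X]eq_bigr => i iu do rewrite leqNgt iu/= addr0.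
rewrite sum_const_hi ?sum_const_lo 1?ltnW// !mulrA !mulVf; first by ring.
  by rewrite pnatr_eq0 -lt0n.
by rewrite pnatr_eq0 subn_eq0 -ltnNge.
Qed.

End Cusum.

(** * Bounds and measurability of the test statistics *)

Section Statistics.
Context {R : realType} {p1 p2 N : nat}.
Implicit Types (mode nu : nat) (X : 'I_N -> 'M[R]_(p1, p2)).

Lemma cusum_le_Tstat mode nu X n :
  (nu <= n <= N - nu)%N -> norm_mode mode (cusum X n) <= Tstat mode nu X.
Proof.
move=> nN; rewrite /Tstat.
by apply: (@le_bigmax_seq _ _ _ _ _ n) => //; rewrite mem_index_iota ltnS.
Qed.

Lemma Tboot_le mode nu e X (m : R) : 0 <= m ->
  (forall n j k, (nu <= n <= N - nu)%N -> `|boot_cusum e X n j k| <= m) ->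
  Tboot mode nu e X <= Num.sqrt (mode_size mode p1 p2)%:R * m.
Proof.
move=> m0 bm; rewrite /Tboot big_seq; apply: bigmax_le => [|n].
  by rewrite mulr_ge0// sqrtr_ge0.
by rewrite mem_index_iota ltnS => nN; apply: norm_mode_le => // j k; exact: bm.
Qed.

Context {d : measure_display} {T : measurableType d}.

Lemma measurable_bigmaxr (I : Type) (r : seq I) (f : I -> T -> R) :
  (forall i, measurable_fun setT (f i)) ->
  measurable_fun setT (fun w => \big[Order.max/0]_(i <- r) f i w).
Proof.
move=> mf; elim: r => [|i r IH].
  rewrite (_ : (fun w => _) = cst 0); first exact: measurable_cst.
  by apply/funext => w; exact: big_nil.
rewrite (_ : (fun w => _) = (f i \max (fun w => \big[Order.max/0]_(i <- r) f i w))).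
  exact: measurable_maxr.
by apply/funext => w; exact: big_cons.
Qed.

Lemma measurable_norm_mode mode (A : T -> 'M[R]_(p1, p2)) :
  (forall j k, measurable_fun setT (fun w => A w j k)) ->
  measurable_fun setT (fun w => norm_mode mode (A w)).
Proof.
have msqrt : measurable_fun setT (@Num.sqrt R).
  by apply: continuous_measurable_fun; exact: sqrt_continuous.
move=> mA; rewrite /norm_mode; case: (mode == 1%N); apply: measurable_bigmaxr => j;
  by apply: (measurableT_comp msqrt); apply: measurable_sum => k; exact: measurable_funX.
Qed.

Lemma measurable_Tstat mode nu (X : T -> 'I_N -> 'M[R]_(p1, p2)) :
  (forall i j k, measurable_fun setT (fun w => X w i j k)) ->
  measurable_fun setT (fun w => Tstat mode nu (X w)).
Proof.
move=> mX; apply: measurable_bigmaxr => n; apply: measurable_norm_mode => j k.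
under eq_fun do rewrite cusum_entry.
by apply: measurable_sum => i; exact: measurable_funM.
Qed.

Lemma measurable_boot_weight (X : T -> 'I_N -> 'M[R]_(p1, p2)) n j k i :
  (forall i j k, measurable_fun setT (fun w => X w i j k)) ->
  measurable_fun setT (fun w => boot_weight (X w) n j k i).
Proof.
move=> mX; have mmean (q : R) (S : pred 'I_N) :
    measurable_fun setT (fun w => (q *: \sum_(i | S i) X w i) j k).
  rewrite (_ : (fun w => _) = (fun w => q * \sum_i (if S i then X w i j k else 0))).
    apply: measurable_funM => //; apply: measurable_sum => i'.
    by case: (S i') => //; exact: measurable_cst.
  by apply/funext => w; rewrite mxE summxE big_mkcond.
apply: measurable_funM => //; apply: measurable_funB => //.
by rewrite /segment_mean; case: (n <= i)%N; exact: mmean.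
Qed.

Lemma measurable_Tboot mode nu (e : 'I_N -> T -> R) (X : T -> 'I_N -> 'M[R]_(p1, p2)) :
  (forall i, measurable_fun setT (e i)) ->
  (forall i j k, measurable_fun setT (fun w => X w i j k)) ->
  measurable_fun setT (fun w => Tboot mode nu (fun i => e i w) (X w)).
Proof.
move=> me mX; apply: measurable_bigmaxr => n; apply: measurable_norm_mode => j k.
under eq_fun do rewrite boot_cusum_entry.
apply: measurable_sum => i; apply: measurable_funM => //.
exact: measurable_boot_weight.
Qed.

End Statistics.

(** * The empirical bootstrap quantile *)

Section Quantile.
Context {R : realType} {B : nat}.
Variables (Tb : 'I_B -> R) (alpha : R).
Hypotheses (B0 : (0 < B)%N) (alpha01 : 0 < alpha < 1).

Let count (t : R) : R := B%:R^-1 * \sum_(b < B) ((Tb b <= t)%R)%:R.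

(** The infimum is attained, as the empirical distribution function is a right-continuous step
    function. Nonemptiness and a lower bound must be shown for [inf] to be meaningful. *)
Lemma boot_quantile_le t : (boot_quantile Tb alpha <= t) = (1 - alpha <= count t).
Proof.
have /andP[a0 a1] := alpha01.
have BR0 : 0 < B%:R^-1 :> R by rewrite invr_gt0 ltr0n.
set S := [set t : R | 1 - alpha <= count t].
have Tb_le b : `|Tb b| <= \sum_(b < B) `|Tb b|.
  by rewrite (bigD1 b)//= lerDl; apply: sumr_ge0.
have Slb : has_lbound S.
  exists (- \sum_(b < B) `|Tb b|) => s /= Ss; rewrite leNgt; apply/negP => sl.
  suff : count s = 0 by move: Ss; rewrite /S/= => + cs; rewrite cs; lra.
  rewrite /count big1 ?mulr0// => b _.
  have := Tb_le b; rewrite ler_norml => /andP[h _].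
  by rewrite leNgt (lt_le_trans sl h).
have S0 : S !=set0.
  exists (\sum_(b < B) `|Tb b|) => /=; rewrite /S/= /count.
  have -> : \sum_(b < B) ((Tb b <= \sum_(b0 < B) `|Tb b0|)%R)%:R = B%:R :> R.
    rewrite (eq_bigr (fun=> 1)) ?sumr_const ?card_ord// => b _.
    by rewrite (le_trans (ler_norm _) (Tb_le b)).
  by rewrite mulVf ?pnatr_eq0 -?lt0n//; lra.
apply/idP/idP => [qt|ct]; last exact: ge_inf.
rewrite leNgt; apply/negP => ct.
(* Next jump after t: [count] does not increase on [t, t'). The default t + 1 keeps t' > t when no
   replicate exceeds t. *)
pose t' := \big[Order.min/(t + 1)]_(b < B | t < Tb b) Tb b.
have tt' : t < t' by apply/bigmin_gtP; split=> //; lra.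
suff : t' <= boot_quantile Tb alpha by move=> h; have := lt_le_trans tt' (le_trans h qt); rewrite ltxx.
apply: lb_le_inf => // s /= Ss; rewrite leNgt; apply/negP => st'.
suff : count s <= count t by move=> h; have := le_lt_trans (le_trans Ss h) ct; rewrite ltxx.
apply: ler_wpM2l; first exact: ltW.
apply: ler_sum => b _; rewrite ler_nat; case: (leP (Tb b) s) => // bs.
rewrite lt0b leNgt; apply/negP => tb.
have : t' <= Tb b by exact: bigmin_le_cond.
by move=> h; have := lt_le_trans st' (le_trans h bs); rewrite ltxx.
Qed.

End Quantile.

(** * Bootstrap replicates conditionally on the data *)

Section Bootstrap.
Context {d : measure_display} {T : measurableType d} {R : realType}.
Variables (P : probability T R) (p1 p2 N B : nat).
Variables (eps : 'I_N -> T -> 'M[R]_(p1, p2)) (e : 'I_B -> 'I_N -> T -> R).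
Hypothesis meps : forall i j k, measurable_fun setT (fun w => eps i w j k).
Hypothesis me : forall b i, measurable_fun setT (e b i).
Hypothesis ind : indep_groups P all_groups (all_vars eps e).
Hypothesis gauss : forall b i (A : set R), measurable A ->
  P (e b i @^-1` A) = normal_prob 0 1 A.

Lemma measurable_all_vars j : measurable_fun setT (all_vars eps e j).
Proof. by case: j => [x|y]; [exact: meps|exact: me]. Qed.
Hint Resolve measurable_all_vars : core.

Variables (A : 'I_N -> 'M[R]_(p1, p2)) (mode nu : nat).
Let X w i := A i + eps i w.

(** Largest conditional variance of a bootstrap entry: the only feature of the data on which the
    tail of T^b is made to depend. *)
Definition boot_var (x : 'I_N -> 'M[R]_(p1, p2)) : R :=
  \big[Order.max/0]_(nu <= n < (N - nu).+1) \big[Order.max/0]_(j < p1)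
    \big[Order.max/0]_(k < p2) \sum_(i < N) boot_weight x n j k i ^+ 2.

Lemma boot_varP x V : boot_var x <= V -> forall n j k, (nu <= n <= N - nu)%N ->
  \sum_(i < N) boot_weight x n j k i ^+ 2 <= V.
Proof.
move=> xV n j k nN; apply: le_trans xV.
apply: (@bigmax_sup_seq _ _ _ _ _ n) => //; first by rewrite mem_index_iota ltnS.
apply: (@bigmax_sup _ _ _ _ j) => //.
exact: (@le_bigmax _ _ _ _ (fun k => \sum_(i < N) boot_weight x n j k i ^+ 2)).
Qed.

Lemma boot_var_le x V : 0 <= V -> (forall n j k, (nu <= n <= N - nu)%N ->
  \sum_(i < N) boot_weight x n j k i ^+ 2 <= V) -> boot_var x <= V.
Proof.
move=> V0 xV; rewrite /boot_var big_seq; apply: bigmax_le => // n.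
rewrite mem_index_iota ltnS => nN.
by apply: bigmax_le => // j _; apply: bigmax_le => // k _; exact: xV.
Qed.

Lemma measurable_boot_var {d'} {T' : measurableType d'} (x : T' -> 'I_N -> 'M[R]_(p1, p2)) :
  (forall i j k, measurable_fun setT (fun w => x w i j k)) ->
  measurable_fun setT (fun w => boot_var (x w)).
Proof.
move=> mx; do 3 (apply: measurable_bigmaxr => ?).
by apply: measurable_sum => i; apply: measurable_funX; exact: measurable_boot_weight.
Qed.

(** Gaussian Chernoff bound with the optimal slope tau / V, then a union over signs, entries and
    split points, whose number is 2 p1 p2 N. *)
Lemma boot_tail b x (V tau : R) : (0 < nu)%N -> 0 < V -> 0 < tau -> boot_var x <= V ->
  (P [set w | (Num.sqrt (mode_size mode p1 p2)%:R * tau <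
       Tboot mode nu (fun i => e b i w) x)%R] <=
   ((p1 * p2 * N)%N%:R * (2 * expR (- (tau ^+ 2 / (2 * V)))))%:E)%E.
Proof.
move=> nu0 V0 tau0 xV.
pose sg (s : bool) : R := (-1) ^+ s.
(* Split points outside [nu, N - nu] get zero weights, so that the union runs over the whole type
   ['I_N]; the relevant n lie in it because nu > 0. *)
pose E (y : bool * 'I_p1 * 'I_p2 * 'I_N) := [set w |
  (tau / V * tau <= \sum_(i < N)
     (fun i y' => tau / V * sg y.1.1.1 *
       (if (nu <= y.2 <= N - nu)%N then boot_weight x y.2 y.1.1.2 y.1.2 i else 0) * y') i
     (e b i w))%R].
have mE y : measurable (E y).
  apply: measurable_set_ler => //; apply: measurable_sum => i.
  exact: measurable_funM.
apply: (@le_trans _ _ (P [set w | exists y, E y w])).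
  apply: le_measure; rewrite ?inE.
  - rewrite [X in measurable X](_ : _ = ~` [set w | Tboot mode nu (fun i => e b i w) x <=
      Num.sqrt (mode_size mode p1 p2)%:R * tau]).
      apply: measurableC; apply: measurable_set_ler => //.
      apply: (@measurable_Tboot _ _ _ _ _ _ mode nu (e b) (fun=> x)).
        exact: me.
      by move=> i j k; exact: measurable_cst.
    by apply/seteqP; split => w /=; rewrite ltNge => /negP.
  - exact: measurable_exists.
  move=> w /=; apply: contraPP => /forallNP nE; apply/negP; rewrite -leNgt.
  apply: Tboot_le; first exact: ltW.
  move=> n j k nN; have nN' : (n < N)%N by lia.
  have H s : sg s * boot_cusum (fun i => e b i w) x n j k <= tau.
    have tV : 0 < tau / V by rewrite divr_gt0.
    rewrite -(ler_pM2l tV) ltW// ltNge; apply/negP => h.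
    apply: (nE (s, j, k, Ordinal nN')) => /=; apply: (le_trans h).
    rewrite nN boot_cusum_entry !mulr_sumr le_eqVlt; apply/orP; left; apply/eqP.
    by apply: eq_bigr => i _; ring.
  have := H false; have := H true; rewrite /sg expr0 expr1 mul1r mulN1r ler_norml => h1 ->.
  by rewrite andbT lerNl.
have -> : (p1 * p2 * N)%N%:R * (2 * expR (- (tau ^+ 2 / (2 * V)))) =
  #|{: bool * 'I_p1 * 'I_p2 * 'I_N}|%:R * expR (- (tau ^+ 2 / (2 * V))) :> R.
  by rewrite !card_prod !card_ord card_bool !natrM; ring.
apply: union_bound => // -[[[s j] k] n].
pose c i := if (nu <= n <= N - nu)%N then boot_weight x n j k i else 0.
have c2 : \sum_(i < N) c i ^+ 2 <= V.
  rewrite /c; case nN : (nu <= n <= N - nu)%N; first exact: (boot_varP xV).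
  by rewrite big1 ?ltW// => i _; rewrite expr0n.
have CH : (P (E (s, j, k, n)) <= (expR (\sum_(i < N) (tau / V * sg s * c i) ^+ 2 / 2 -
    tau / V * tau))%:E)%E.
  apply: (@chernoff_indep _ _ _ P _ _ all_groups (all_vars eps e) measurable_all_vars ind
    'I_N predT (fun i => inr (b, i)) (fun i y => tau / V * sg s * c i * y)
    (fun i => (tau / V * sg s * c i) ^+ 2 / 2) (tau / V * tau)).
  - by move=> i i' [].
  - by move=> i; exact: measurable_funM.
  - by move=> i /=; rewrite gaussian_mgf//; exact: gauss.
apply: (le_trans CH).
rewrite lee_fin ler_expR.
  have -> : \sum_(i < N) (tau / V * sg s * c i) ^+ 2 / 2 =
    (tau / V) ^+ 2 / 2 * \sum_(i < N) c i ^+ 2.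
    rewrite mulr_sumr; apply: eq_bigr => i _; rewrite !exprMn /sg sqrr_sign; ring.
  have h : (tau / V) ^+ 2 / 2 * \sum_(i < N) c i ^+ 2 <= (tau / V) ^+ 2 / 2 * V.
    by apply: ler_wpM2l => //; rewrite mulr_ge0// sqr_ge0.
  apply: (@le_trans _ _ ((tau / V) ^+ 2 / 2 * V - tau / V * tau)); first lra.
  rewrite le_eqVlt; apply/orP; left; apply/eqP; field; exact: lt0r_neq0.
Qed.


Let exceeds t b (x : 'I_N -> 'M[R]_(p1, p2)) w : bool := t < Tboot mode nu (fun i => e b i w) x.

Lemma measurable_boolR {d'} {T' : measurableType d'} (f : T' -> bool) :
  measurable_fun setT f -> measurable_fun setT (fun w => (f w)%:R : R).
Proof.
move=> mf _ Y _; rewrite setTI.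
have := mf measurableT [set b : bool | Y b%:R] Logic.I.
by rewrite setTI.
Qed.

(* The factor [1 + 3 * 1_{t < T^b}] dominates [exp 1_{t < T^b}] as [e <= 4]; the
   replicates are integrated out one at a time, given [X]. *)
Lemma boot_count (bs : seq 'I_B) (V t r : R) : uniq bs -> 0 <= r ->
  (forall b x, boot_var x <= V -> (P [set w | exceeds t b x w] <= r%:E)%E) ->
  (\int[P]_w ((boot_var (X w) <= V)%R%:R *
      \prod_(b <- bs) (1 + 3 * (exceeds t b (X w) w)%:R))%:E <=
   ((1 + 3 * r) ^+ size bs)%:E)%E.
Proof.
move=> + r0 tail; elim: bs => [_|b bs IH /= /andP[bbs ubs]].
  rewrite expr0; apply: (@le_trans _ _ (\int[P]_w 1%:E)%E); last first.
    by rewrite integral_cst// mul1e; exact: probability_le1.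
  apply: ge0_le_integral => //.
  - by move=> w _; rewrite lee_fin big_nil mulr1.
  - apply/measurable_EFinP; under eq_fun do rewrite big_nil mulr1.
    apply: measurable_boolR; apply: measurable_fun_ler => //.
    by apply: measurable_boot_var => i j k; under eq_fun do rewrite mxE; exact: measurable_funD.
  - by move=> w _; rewrite lee_fin big_nil mulr1 lern1 leq_b1.
(* [K1] holds the noise and the replicates in [bs], [K2] the multipliers of [b] alone. In [F w w']
   the second point feeds only replicate [b]. *)
pose K1 (i : 'I_N + 'I_B * 'I_N) := match i with inl _ => true | inr y => y.1 \in bs end.
pose K2 (i : 'I_N + 'I_B * 'I_N) := match i with inl _ => false | inr y => y.1 == b end.
pose F w w' : R := (boot_var (X w) <= V)%R%:R *
      \prod_(b <- bs) (1 + 3 * (exceeds t b (X w) w)%:R) * (1 + 3 * (exceeds t b (X w) w')%:R).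
have F0 w w' : 0 <= F w w'.
  rewrite !mulr_ge0 ?addr_ge0 ?mulr_ge0//.
  by apply: prodr_ge0 => b' _; rewrite addr_ge0 ?mulr_ge0.
pose TK := sub_space (d := d) (T := T) (R := R) all_groups (all_vars eps e).
have mX (d' : measure_display) (T' : measurableType d') (f : T' -> T) :
    (forall i j k, measurable_fun setT (fun z => eps i (f z) j k)) ->
    forall i j k, measurable_fun setT (fun z => X (f z) i j k).
  by move=> mf i j k; under eq_fun do rewrite mxE; exact: measurable_funD.
have mh (d' : measure_display) (T' : measurableType d') (f : T' -> T) :
    (forall i j k, measurable_fun setT (fun z => eps i (f z) j k)) ->
    measurable_fun setT (fun z => (boot_var (X (f z)) <= V)%R%:R : R).
  move=> mf; apply: measurable_boolR; apply: measurable_fun_ler => //.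
  by apply: measurable_boot_var; exact: mX.
have mI (d' : measure_display) (T' : measurableType d') b' (f f' : T' -> T) :
    (forall i j k, measurable_fun setT (fun z => eps i (f z) j k)) ->
    (forall i, measurable_fun setT (fun z => e b' i (f' z))) ->
    measurable_fun setT (fun z => 1 + 3 * (exceeds t b' (X (f z)) (f' z))%:R : R).
  move=> mf mf'; apply: measurable_funD => //; apply: measurable_funM => //.
  apply: measurable_boolR; apply: measurable_fun_ltr => //.
  by apply: measurable_Tboot => //; exact: mX.
pose c w : R := (boot_var (X w) <= V)%R%:R *
      \prod_(b <- bs) (1 + 3 * (exceeds t b (X w) w)%:R).
have c0 w : 0 <= c w.
  by rewrite mulr_ge0// prodr_ge0// => b' _; rewrite addr_ge0 ?mulr_ge0.
have mc : measurable_fun setT c.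
  apply: measurable_funM; first exact: (mh _ _ id).
  by apply: measurable_prod => b' _; apply: (mI _ _ _ id id).
rewrite (eq_integral (fun w => (F w w)%:E)); last first.
  by move=> w _; rewrite /F big_cons; congr EFin; ring.
apply: (@le_trans _ _ (\int[P]_w ((c w)%:E * (1 + 3 * r)%:E))%E).
  apply: (@fubini_indep_le _ _ _ P _ _ all_groups (all_vars eps e)
    measurable_all_vars ind K1 K2 (fun w w' => (F w w')%:E)).
  - by case=> // -[b' i] /=; apply: contra bbs => /andP[+ /eqP <-].
  - have meps1 i j k : measurable_fun [set: TK K1 * TK K2] (fun z => eps i z.1 j k).
      apply: (@measurableT_comp _ _ _ _ _ _ (fun w : TK K1 => eps i w j k)) => //.
      exact: (@measurable_coord_sub _ _ _ _ _ all_groups (all_vars eps e) K1 (inl (i, j, k))).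
    apply/measurable_EFinP; apply: measurable_funM; first apply: measurable_funM.
    + by apply: (mh _ (TK K1 * TK K2)%type fst).
    + apply: measurable_prod => b' b'bs; apply: (mI _ (TK K1 * TK K2)%type b' fst fst) => // i.
      apply: (@measurableT_comp _ _ _ _ _ _ (fun w : TK K1 => e b' i w)) => //.
      exact: (@measurable_coord_sub _ _ _ _ _ all_groups (all_vars eps e) K1 (inr (b', i))).
    + apply: (mI _ (TK K1 * TK K2)%type b fst snd) => // i.
      apply: (@measurableT_comp _ _ _ _ _ _ (fun w : TK K2 => e b i w)) => //.
      apply: (@measurable_coord_sub _ _ _ _ _ all_groups (all_vars eps e) K2 (inr (b, i))).
      exact: eqxx.
  - by move=> w w'; rewrite lee_fin.
  - by apply: emeasurable_funM => //; exact/measurable_EFinP.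
  move=> w; rewrite /F -/(c w).
  under eq_integral do rewrite EFinM.
  have mEf : measurable_fun setT (exceeds t b (X w)).
    apply: measurable_fun_ltr => //; apply: measurable_Tboot; first exact: me.
    by move=> i j k; exact: measurable_cst.
  pose E := [set w' | exceeds t b (X w) w'].
  have mE : measurable E.
    by have := mEf measurableT [set true] Logic.I; rewrite setTI.
  have m1 : measurable_fun setT (fun w' => (\1_E w' : R)) by exact: measurable_indic.
  have -> : (\int[P]_w' ((c w)%:E * (1 + 3 * (exceeds t b (X w) w')%:R)%:E) =
      (c w)%:E * \int[P]_w' (1%:E + 3%:E * (\1_E w')%:E))%E.
    rewrite -ge0_integralZl//; last 3 first.
    - by apply: emeasurable_funD => //; apply: emeasurable_funM => //; exact/measurable_EFinP.
    - by move=> w' _; rewrite adde_ge0// mule_ge0// lee_fin.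
    - by rewrite lee_fin.
    apply: eq_integral => w' _.
    have -> : \1_E w' = (exceeds t b (X w) w')%:R :> R.
      by rewrite indicE; congr ((_ : bool)%:R); apply/idP/idP => [/set_mem|] //; rewrite inE.
    by [].
  have [xV|xV] := boolP (boot_var (X w) <= V); last first.
    by rewrite /c (negbTE xV) mul0r !mul0e.
  apply: lee_wpmul2l; first by rewrite lee_fin.
  rewrite ge0_integralD//; last by apply: emeasurable_funM => //; exact/measurable_EFinP.
  rewrite ge0_integralZl//; last exact/measurable_EFinP.
  rewrite integral_indic// setIT integral_cst// mul1e (EFinD 1 (3 * r)) EFinM.
  apply: leeD; first exact: probability_le1.
  by apply: lee_wpmul2l => //; exact: tail.
rewrite ge0_integralZr//.
- rewrite exprSr (EFinM (_ ^+ _)) lee_wpmul2r ?lee_fin ?addr_ge0 ?mulr_ge0//.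
  exact: IH.
- exact/measurable_EFinP.
- by move=> w _; rewrite lee_fin.
- by rewrite lee_fin addr_ge0 ?mulr_ge0.
Qed.

(** Chernoff with slope 1: (1 + 3 r)^B exp (- alpha B) <= exp ((3 r - alpha) B), and 3 r - alpha <=
    - 5 alpha / 8 <= - alpha^2 / 2 since r <= alpha / 8 and alpha <= 1. *)
Lemma boot_exceed (V t r alpha : R) : 0 <= r -> 8 * r <= alpha -> alpha <= 1 ->
  (forall b x, boot_var x <= V -> (P [set w | exceeds t b x w] <= r%:E)%E) ->
  let S := [set w | (boot_var (X w) <= V)%R /\
      (alpha * B%:R <= \sum_(b < B) (exceeds t b (X w) w)%:R)%R] in
  measurable S /\ (P S <= (expR (- (alpha ^+ 2 * B%:R / 2)))%:E)%E.
Proof.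
move=> r0 r8 a1 tail S.
have mX i j k : measurable_fun setT (fun w => X w i j k).
  by under eq_fun do rewrite mxE; exact: measurable_funD.
have mI b : measurable_fun setT (fun w => (exceeds t b (X w) w)%:R : R).
  by apply: measurable_boolR; apply: measurable_fun_ltr => //; exact: measurable_Tboot.
have mh : measurable_fun setT (fun w => boot_var (X w)) by exact: measurable_boot_var.
have mS : measurable S.
  by apply: measurableI; apply: measurable_set_ler => //; exact: measurable_sum.
split => //.
pose c w : R := (boot_var (X w) <= V)%R%:R *
      \prod_(b <- index_enum 'I_B) (1 + 3 * (exceeds t b (X w) w)%:R).
have c0 w : 0 <= c w.
  by rewrite mulr_ge0// prodr_ge0// => b' _; rewrite addr_ge0 ?mulr_ge0.
have mc : measurable_fun setT c.
  apply: measurable_funM; first by apply: measurable_boolR; exact: measurable_fun_ler.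
  apply: measurable_prod => b _; apply: measurable_funD => //.
  exact: measurable_funM.
apply: (@le_trans _ _ (\int[P]_w (c w * expR (- (alpha * B%:R)))%:E)%E).
  apply: le_probability_integral.
  - exact: mS.
  - exact: measurable_funM.
  - by move=> w; rewrite mulr_ge0// expR_ge0.
  - move=> w /= [xV ab]; rewrite /c xV mul1r expRN -ler_pdivrMr ?invr_gt0 ?expR_gt0//.
    rewrite invrK mul1r; apply: (@le_trans _ _ (expR (\sum_(b < B) (exceeds t b (X w) w)%:R))).
      by rewrite ler_expR.
    rewrite expR_sum; apply: ler_prod => b _; rewrite expR_ge0/=.
    case: exceeds; last by rewrite expR0 mulr0 addr0.
    by rewrite /= mulr1; have := @expR1_le4 R; lra.
under eq_integral do rewrite EFinM.
rewrite ge0_integralZr ?lee_fin ?expR_ge0//; last 2 first.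
- exact/measurable_EFinP.
- by move=> w _; rewrite lee_fin.
have H := @boot_count (index_enum 'I_B) V t r (index_enum_uniq _) r0 tail.
apply: (@le_trans _ _ (((1 + 3 * r) ^+ B)%:E * (expR (- (alpha * B%:R)))%:E)%E).
  apply: lee_wpmul2r; first by rewrite lee_fin expR_ge0.
  have sB : size (index_enum 'I_B) = B by rewrite -[RHS](card_ord B) cardT enumT.
  by rewrite sB in H.
rewrite -EFinM lee_fin.
apply: (@le_trans _ _ (expR (3 * r * B%:R) * expR (- (alpha * B%:R)))).
  apply: ler_wpM2r; first exact: expR_ge0.
  rewrite expRM_natr lerXn2r ?nnegrE ?expR_ge0 ?addr_ge0 ?mulr_ge0//.
  exact: expR_ge1Dx.
rewrite -expRD ler_expR.
have B0 : 0 <= B%:R :> R by [].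
have h : 3 * r - alpha + alpha ^+ 2 / 2 <= 0 by nra.
have := ler_wpM2r B0 h; lra.
Qed.
End Bootstrap.

(** * The exceptional event for the noise *)

Section Noise.
Context {d : measure_display} {T : measurableType d} {R : realType}.
Variables (P : probability T R) (p1 p2 N B : nat).
Variables (eps : 'I_N -> T -> 'M[R]_(p1, p2)) (e : 'I_B -> 'I_N -> T -> R) (D : R).
Hypothesis meps : forall i j k, measurable_fun setT (fun w => eps i w j k).
Hypothesis me : forall b i, measurable_fun setT (e b i).
Hypothesis ind : indep_groups P all_groups (all_vars eps e).
Hypothesis D1 : 1 <= D.
Hypothesis eps_mean : forall i j k,
  P.-integrable setT (fun w => (eps i w j k)%:E) /\ (\int[P]_w (eps i w j k)%:E = 0)%E.
Hypothesis eps_exp : forall i j k, (\int[P]_w (expR (`|eps i w j k| / D))%:E <= 2%:E)%E.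
Variables (nu u : nat).
Let q : R := (p1 * p2 * N)%N%:R.
Let L : R := ln q.
Hypotheses (nu0 : (0 < nu)%N) (uN : (nu <= u <= N - nu)%N) (L1 : 1 <= L)
  (nuL : 16 * L ^+ 5 <= nu%:R).

Let D0 : 0 < D. Proof. exact: lt_le_trans D1. Qed.
Let q0 : 0 < q.
Proof. by rewrite ltNge; apply/negP => h; have := ln0 h; move: L1; rewrite /L => + E; rewrite E; lra. Qed.
Let expL : expR (- (2 * L)) = q^-1 * q^-1.
Proof. by rewrite expRN (_ : 2 * L = L + L) ?expRD ?lnK ?posrE ?invfM//; ring. Qed.

(** The level 2 L makes each of the q tails at most 2 / q^2. *)
Lemma noise_large : (P [set w | exists y : 'I_N * 'I_p1 * 'I_p2,
  (2 * L <= `|eps y.1.1 w y.1.2 y.2| / D)%R] <= (2 / q)%:E)%E.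
Proof.
have -> : 2 / q = #|{: 'I_N * 'I_p1 * 'I_p2}|%:R * (2 * expR (- (2 * L))) :> R.
  rewrite !card_prod !card_ord expL !natrM /q !natrM.
  by move: (gt_eqF q0); rewrite /q !natrM !mulf_eq0 => /norP[/norP[? ?] ?]; field; apply/and3P.
apply: union_bound => -[[i j] k] /=.
  apply: measurable_set_ler => //; apply: measurable_funM => //.
  exact: measurableT_comp.
exact: subexp_tail.
Qed.

Let segment (y : bool * 'I_N) : pred 'I_N :=
  fun i => if y.1 then (y.2 <= i)%N else (i < y.2)%N.
Let segment_size (y : bool * 'I_N) : R := (if y.1 then (N - y.2)%N else y.2 : nat)%:R.

Let trunc i j k w : R := Num.min ((eps i w j k / D) ^+ 2) (4 * L ^+ 2).

(* On the complement of the event of [noise_large] the truncation is inactive. *)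
Lemma noise_sqr_mean : (P [set w | exists y : bool * 'I_N * 'I_p1 * 'I_p2,
  ((nu <= y.1.1.2 <= N - nu)%N /\ 16 * segment_size y.1.1 <=
     \sum_(i | segment y.1.1 i) trunc i y.1.2 y.2 w)%R] <= (2 / q)%:E)%E.
Proof.
have L0 : 0 < L by exact: lt_le_trans L1.
have mtr i j k : measurable_fun setT (trunc i j k).
  by apply: measurable_minr => //; apply: measurable_funX; exact: measurable_funM.
pose A' y := [set w | 16 * segment_size y.1.1 <=
  \sum_(i | segment y.1.1 i) trunc i y.1.2 y.2 w].
have mA' y : measurable (A' y).
  apply: measurable_set_ler => //; under eq_fun do rewrite big_mkcond/=.
  by apply: measurable_sum => i; case: (segment _ _).
pose A (y : bool * 'I_N * 'I_p1 * 'I_p2) :=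
  if (nu <= y.1.1.2 <= N - nu)%N then A' y else set0.
rewrite (_ : [set w | _] = [set w | exists y, A y w]); last first.
  apply/seteqP; split=> w [y]; rewrite /A; first by move=> [yN h]; exists y; rewrite yN.
  by case: ifP => // yN h; exists y.
have -> : 2 / q = #|{: bool * 'I_N * 'I_p1 * 'I_p2}|%:R * expR (- (2 * L)) :> R.
  rewrite !card_prod !card_ord card_bool expL !natrM /q !natrM.
  by move: (gt_eqF q0); rewrite /q !natrM !mulf_eq0 => /norP[/norP[? ?] ?]; field; apply/and3P.
apply: union_bound => y; rewrite /A; case: ifP => // nN; last by rewrite measure0 lee_fin expR_ge0.
case: y nN => -[[b n] j] k nN.
set m := segment_size (b, n).
have mnu : nu%:R <= m by rewrite /m /segment_size ler_nat/=; case: (b); move: nN => /=; lia.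
(* The largest slope allowed by [subexp_trunc_sqr_mgf]: l * (4 L^2) = 1/2. *)
pose l : R := (8 * L ^+ 2)^-1.
have l0 : 0 < l by rewrite invr_gt0 mulr_gt0// exprn_gt0.
apply: (@le_trans _ _ (P [set w | (l * (16 * m) <=
    \sum_(i | segment (b, n) i) l * trunc i j k w)%R])).
  apply: le_measure; rewrite ?inE.
  - exact: mA'.
  - apply: measurable_set_ler => //; under eq_fun do rewrite big_mkcond/=.
    by apply: measurable_sum => i; case: (segment _ _) => //; exact: measurable_funM.
  - by move=> w /= h; rewrite -mulr_sumr ler_pM2l.
have CH : (P [set w | (l * (16 * m) <= \sum_(i | segment (b, n) i) l * trunc i j k w)%R] <=
    (expR (\sum_(i | segment (b, n) i) 8 * l - l * (16 * m)))%:E)%E.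
  apply: (@chernoff_indep _ _ _ P _ _ all_groups (all_vars eps e) _ ind
    'I_N (segment (b, n)) (fun i => inl (i, j, k))
    (fun i y => l * Num.min ((y / D) ^+ 2) (4 * L ^+ 2)) (fun i => 8 * l) (l * (16 * m))).
  - exact: measurable_all_vars.
  - by move=> i i' [].
  - move=> i; apply: measurable_funM => //; apply: measurable_minr => //.
    by apply: measurable_funX; exact: measurable_funM.
  - move=> i /=; apply: subexp_trunc_sqr_mgf => //; first exact: ltW.
    + by rewrite le_eqVlt; apply/orP; left; apply/eqP; rewrite /l; field; exact: lt0r_neq0.
    + by rewrite mulr_ge0// sqr_ge0.
apply: (le_trans CH); rewrite lee_fin ler_expR.
have -> : \sum_(i | segment (b, n) i) 8 * l = m * (8 * l).
  rewrite /m /segment /segment_size/=; case: (b); first by rewrite sum_const_hi// ltnW.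
  by rewrite sum_const_lo// ltnW.
(* The net exponent is 8 l m - 16 l m = - m / L^2, at most - 2 L because m >= nu >= 16 L^5 >= 2
   L^3. *)
have h : 2 * L <= m * (8 * l).
  have -> : m * (8 * l) = m / L ^+ 2 by rewrite /l; field; exact: lt0r_neq0.
  rewrite ler_pdivlMr ?exprn_gt0//; apply: (le_trans _ (le_trans nuL mnu)).
  have h2 : L ^+ 3 <= L ^+ 5 by apply: ler_weXn2l.
  have -> : 2 * L * L ^+ 2 = 2 * L ^+ 3 by ring.
  have := exprn_gt0 3 L0; lra.
lra.
Qed.

(** Chernoff with slope sqrt L / D: the moment generating functions cost 16 L, since the squared
    weights sum to at most 1, and 18 = 16 + 2 leaves the exponent - 2 L. *)
Lemma noise_cusum : (P [set w | exists y : bool * 'I_p1 * 'I_p2,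
  (18 * Num.sqrt L * D <= (-1) ^+ y.1.1 * cusum (fun i => eps i w) u y.1.2 y.2)%R] <=
  (2 / q)%:E)%E.
Proof.
have L0 : 0 < L by exact: lt_le_trans L1.
have uN' : (0 < u < N)%N by lia.
pose sg (s : bool) : R := (-1) ^+ s.
pose a s (i : 'I_N) : R := sg s * cusum_weight u i.
have a2 s i : a s i ^+ 2 = cusum_weight u i ^+ 2 by rewrite /a exprMn /sg sqrr_sign mul1r.
pose A (y : bool * 'I_p1 * 'I_p2) := [set w | Num.sqrt L * (18 * Num.sqrt L) <=
  \sum_(i < N) Num.sqrt L * a y.1.1 i / D * eps i w y.1.2 y.2].
have sqrtL0 : 0 < Num.sqrt L by rewrite sqrtr_gt0.
have sqrtL2 : Num.sqrt L * Num.sqrt L = L by rewrite -expr2 sqr_sqrtr// ltW.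
have mA y : measurable (A y).
  by apply: measurable_set_ler => //; apply: measurable_sum => i; exact: measurable_funM.
have AE : [set w | exists y : bool * 'I_p1 * 'I_p2,
    18 * Num.sqrt L * D <= (-1) ^+ y.1.1 * cusum (fun i => eps i w) u y.1.2 y.2] =
    [set w | exists y, A y w].
  suff H (y : bool * 'I_p1 * 'I_p2) w : (18 * Num.sqrt L * D <= (-1) ^+ y.1.1 * cusum (fun i => eps i w) u y.1.2 y.2) <->
    A y w by apply/seteqP; split=> w [y /H]; exists y.
  have tD : 0 < Num.sqrt L / D by rewrite divr_gt0.
  rewrite /A/= cusum_entry -(ler_pM2l tD).
  have -> : Num.sqrt L / D * (18 * Num.sqrt L * D) = Num.sqrt L * (18 * Num.sqrt L).
    by field; exact: lt0r_neq0.
  suff -> : Num.sqrt L / D * ((-1) ^+ y.1.1 * \sum_(i < N) cusum_weight u i * eps i w y.1.2 y.2) =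
    \sum_(i < N) Num.sqrt L * a y.1.1 i / D * eps i w y.1.2 y.2 by [].
  rewrite !mulr_sumr; apply: eq_bigr => i _.
  by rewrite /a /sg; set z := (-1) ^+ _; ring.
rewrite AE; apply: (@le_trans _ _ (#|{: bool * 'I_p1 * 'I_p2}|%:R * expR (- (2 * L)))%:E).
  apply: union_bound => // -[[s j] k].
  have CH : (P (A (s, j, k)) <= (expR (\sum_(i < N) 16 * (Num.sqrt L * a s i) ^+ 2 -
      Num.sqrt L * (18 * Num.sqrt L)))%:E)%E.
    apply: (@chernoff_indep _ _ _ P _ _ all_groups (all_vars eps e) _ ind
      'I_N predT (fun i => inl (i, j, k))
      (fun i y => Num.sqrt L * a s i / D * y) (fun i => 16 * (Num.sqrt L * a s i) ^+ 2)).
    - exact: measurable_all_vars.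
    - by move=> i i' [].
    - by move=> i; exact: measurable_funM.
    - move=> i /=; have [iY Y0] := eps_mean i j k.
      (* The slope condition, squared, follows from L / nu <= 1/4. *)
      apply: subexp_mgf => //; rewrite -(@ler_pXn2r _ 2%N)// ?nnegrE//.
      rewrite real_normK ?num_real// exprMn a2 sqr_sqrtr; last exact: ltW.
      have h := @cusum_weight_le R N nu u i nu0 (proj1 (andP uN)) (proj2 (andP uN)) (proj2 (andP uN')).
      apply: (@le_trans _ _ (L * nu%:R^-1)); first by rewrite ler_pM2l.
      have nuR : 0 < nu%:R :> R by rewrite ltr0n.
      rewrite ler_pdivrMr//; apply: (@le_trans _ _ (2^-1 ^+ 2 * (16 * L ^+ 5))).
        have : L ^+ 1 <= L ^+ 5 by apply: ler_weXn2l.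
        by rewrite expr1; lra.
      by rewrite ler_pM2l// exprn_gt0.
  apply: (le_trans CH); rewrite lee_fin ler_expR.
  have -> : \sum_(i < N) 16 * (Num.sqrt L * a s i) ^+ 2 =
      16 * L * \sum_(i < N) cusum_weight u i ^+ 2.
    rewrite mulr_sumr; apply: eq_bigr => i _.
    by rewrite exprMn a2 sqr_sqrtr ?mulrA// ltW.
  have h := @cusum_weight_sqr_sum R N u uN'.
  have L16 : 0 <= 16 * L by rewrite mulr_ge0// ltW.
  have := ler_wpM2l L16 h.
  have -> : Num.sqrt L * (18 * Num.sqrt L) = 18 * L by rewrite mulrCA sqrtL2.
  lra.
rewrite lee_fin !card_prod !card_ord card_bool expL !natrM -/q.
have NE : p1%:R * p2%:R * N%:R = q by rewrite /q !natrM.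
have N1 : 1 <= N%:R :> R by rewrite ler1n; lia.
rewrite mulrA ler_pM2r ?invr_gt0// ler_pdivrMr// -NE.
have : 0 <= p1%:R * p2%:R :> R by rewrite mulr_ge0.
nra.
Qed.

Definition noise_bad : set T :=
  [set w | exists y : 'I_N * 'I_p1 * 'I_p2, 2 * L <= `|eps y.1.1 w y.1.2 y.2| / D] `|`
  [set w | exists y : bool * 'I_N * 'I_p1 * 'I_p2,
    (nu <= y.1.1.2 <= N - nu)%N /\ 16 * segment_size y.1.1 <=
     \sum_(i | segment y.1.1 i) trunc i y.1.2 y.2 w] `|`
  [set w | exists y : bool * 'I_p1 * 'I_p2,
    18 * Num.sqrt L * D <= (-1) ^+ y.1.1 * cusum (fun i => eps i w) u y.1.2 y.2].

Lemma noise_good_cusum w : ~ noise_bad w -> forall j k,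
  `|cusum (fun i => eps i w) u j k| <= 18 * Num.sqrt L * D.
Proof.
move=> /not_orP[_ /forallNP nb] j k.
have H (s : bool) : (-1) ^+ s * cusum (fun i => eps i w) u j k <= 18 * Num.sqrt L * D.
  by rewrite leNgt; apply/negP => h; apply: (nb (s, j, k)) => /=; exact: ltW.
have := H false; have := H true; rewrite expr0 expr1 mul1r mulN1r ler_norml => h1 ->.
by rewrite andbT lerNl.
Qed.

(* (delta + eps)^2 <= 2 + 2 eps^2, and eps^2 averages to at most 16 D^2. *)
Lemma noise_good_var (mu delta : 'M[R]_(p1, p2)) w : norminf delta <= 1 ->
  ~ noise_bad w ->
  boot_var nu (fun i => mu + (if (u <= i)%N then delta else 0) + eps i w) <= 34 * D ^+ 2.
Proof.
move=> delta1 /not_orP[/not_orP[/forallNP nlarge /forallNP nmean] _].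
have delta_le j k : `|delta j k| <= 1.
  apply: le_trans delta1; apply: (@bigmax_sup _ _ _ _ j) => //.
  exact: (@le_bigmax _ _ _ _ (fun k => `|delta j k|)).
have trE i j k : trunc i j k w = (eps i w j k / D) ^+ 2.
  rewrite /trunc; apply/min_idPl.
  have : `|eps i w j k| / D <= 2 * L.
    by rewrite leNgt; apply/negP => h; apply: (nlarge (i, j, k)); exact: ltW.
  have -> : `|eps i w j k| / D = `|eps i w j k / D| by rewrite normrM normfV (gtr0_norm D0).
  rewrite -[in X in _ -> X](real_normK (num_real (eps i w j k / D))).
  by have := normr_ge0 (eps i w j k / D); nra.
have D2 : 1 <= D ^+ 2 by rewrite exprn_ege1.
apply: boot_var_le => [|n j k nN]; first by rewrite mulr_ge0// sqr_ge0.
have nN' : (0 < n < N)%N by lia.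
have /andP[n0 nltN] := nN'.
(* The centre is [mu j k] on both segments, wherever n lies relative to u. The constant is 34 = 2 +
   2 * 16, using D >= 1. *)
have seg (b : bool) : \sum_(i | segment (b, Ordinal nltN) i)
     ((mu + (if (u <= i)%N then delta else 0) + eps i w) j k - mu j k) ^+ 2 <=
     segment_size (b, Ordinal nltN) * (34 * D ^+ 2).
  have h : \sum_(i | segment (b, Ordinal nltN) i) trunc i j k w <=
      16 * segment_size (b, Ordinal nltN).
    by rewrite leNgt; apply/negP => h; apply: (nmean (b, Ordinal nltN, j, k)); split => //; exact: ltW.
  apply: (@le_trans _ _ (\sum_(i | segment (b, Ordinal nltN) i)
      (2 + 2 * D ^+ 2 * trunc i j k w))).
    apply: ler_sum => i _; rewrite trE !mxE.
    have -> : 2 * D ^+ 2 * (eps i w j k / D) ^+ 2 = 2 * eps i w j k ^+ 2.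
      by field; exact: lt0r_neq0.
    pose x : R := (if (u <= i)%N then delta else 0) j k; rewrite -/x.
    have : x ^+ 2 <= 1.
      rewrite /x; case: (u <= i)%N; last by rewrite mxE expr0n.
      by rewrite -(real_normK (num_real _)) expr_le1.
    have := sqr_ge0 (x - eps i w j k); nra.
  rewrite big_split/= -mulr_sumr.
  have -> : \sum_(i | segment (b, Ordinal nltN) i) 2 = segment_size (b, Ordinal nltN) * 2.
    rewrite /segment /segment_size/=; case: (b); first by rewrite sum_const_hi// ltnW.
    by rewrite sum_const_lo// ltnW.
  have s0 : 0 <= segment_size (b, Ordinal nltN) by [].
  have D20 : 0 <= 2 * D ^+ 2 by rewrite mulr_ge0// sqr_ge0.
  have := ler_wpM2l D20 h; have := ler_wpM2l s0 D2; lra.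
apply: (@boot_weight_sqr_sum _ _ _ _ _ _ _ _ _ (fun=> mu j k)) => //.
- exact: (seg true).
- exact: (seg false).
Qed.

Lemma measurable_noise_bad : measurable noise_bad /\ (P noise_bad <= (6 / q)%:E)%E.
Proof.
have mc (b : bool) : measurable [set _ : T | b].
  case: b; first by rewrite (_ : [set _ : T | true] = setT)//; apply/seteqP; split.
  by rewrite (_ : [set _ : T | false] = set0)//; apply/seteqP; split.
have m1 : measurable [set w | exists y : 'I_N * 'I_p1 * 'I_p2,
    2 * L <= `|eps y.1.1 w y.1.2 y.2| / D].
  apply: measurable_exists => y; apply: measurable_set_ler => //; apply: measurable_funM => //.
  exact: measurableT_comp.
have m2 : measurable [set w | exists y : bool * 'I_N * 'I_p1 * 'I_p2,
    (nu <= y.1.1.2 <= N - nu)%N /\ 16 * segment_size y.1.1 <=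
     \sum_(i | segment y.1.1 i) trunc i y.1.2 y.2 w].
  apply: measurable_exists => y; apply: measurableI; first exact: mc.
  apply: measurable_set_ler => //; under eq_fun do rewrite big_mkcond/=.
  apply: measurable_sum => i; case: (segment _ _) => //.
  by apply: measurable_minr => //; apply: measurable_funX; exact: measurable_funM.
have m3 : measurable [set w | exists y : bool * 'I_p1 * 'I_p2,
    18 * Num.sqrt L * D <= (-1) ^+ y.1.1 * cusum (fun i => eps i w) u y.1.2 y.2].
  apply: measurable_exists => y; apply: measurable_set_ler => //; apply: measurable_funM => //.
  under eq_fun do rewrite cusum_entry.
  by apply: measurable_sum => i; exact: measurable_funM.
split; first by apply: measurableU => //; exact: measurableU.
have -> : 6 / q = 2 / q + 2 / q + 2 / q by lra.
rewrite !EFinD; apply: (le_trans (measureU2 _ _ _)) => //; first exact: measurableU.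
apply: leeD; last exact: noise_cusum.
apply: (le_trans (measureU2 _ _ _)) => //.
by apply: leeD; [exact: noise_large|exact: noise_sqr_mean].
Qed.
End Noise.

(** * Numerical consequences of the rate and separation conditions *)

Section Numeric.
Context {R : realType}.
Implicit Types (D s L n q alpha : R).

(** L^5 / n <= eta^4 because D, s >= 1, and eta^4 is below both 1/16 and eta once eta < 1/6;
    moreover 1/q <= 1/n <= L^5 / n. *)
Lemma rate_small D s L n q : 1 <= D -> 1 <= s -> 1 <= L -> 0 < n -> n <= q ->
  let eta := (D ^+ 2 * s ^+ 5 * L ^+ 5 / n) `^ (4%:R^-1) in
  6 * eta < 1 -> 16 * L ^+ 5 <= n /\ q^-1 <= eta.
Proof.
move=> D1 s1 L1 n0 nq; set Q := _ / n => eta eta6.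
have L0 : 0 < L ^+ 5 by rewrite exprn_gt0// (lt_le_trans _ L1).
have QL : L ^+ 5 / n <= Q.
  rewrite /Q ler_pM2r ?invr_gt0// ler_peMl ?(ltW L0)//.
  by rewrite mulr_ege1// exprn_ege1.
have Q0 : 0 <= Q by apply: le_trans QL; rewrite divr_ge0// ltW.
have eta0 : 0 <= eta by exact: powR_ge0.
have eta4 : eta ^+ 4 = Q by rewrite -powR_mulrn// /eta -powRrM mulVf// powRr1.
clearbody Q eta.
have e6 : eta <= 6^-1 by lra.
have Qeta : Q <= eta.
  by rewrite -eta4 -[leRHS]expr1; apply: ler_wiXn2l => //; lra.
split.
  have h : eta ^+ 4 <= 6^-1 ^+ 4 by apply: lerXn2r; rewrite ?nnegrE//; lra.
  have : L ^+ 5 / n <= 16^-1.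
    apply: (le_trans QL); rewrite -eta4; apply: (le_trans h).
    by rewrite exprVn lef_pV2 ?posrE ?exprn_gt0// -natrX ler_nat.
  by rewrite ler_pdivrMr//; lra.
apply: le_trans (le_trans QL Qeta); apply: (@le_trans _ _ (n^-1)).
  by rewrite lef_pV2 ?posrE// (lt_le_trans n0).
by rewrite ler_peMl ?invr_ge0 ?exprn_ege1// ltW.
Qed.

(** The level 15 is chosen so that 15^2 / 68 >= 3: the exponential is then at most (alpha / (2
    q))^3, which absorbs the factor 2 q. *)
Lemma gauss_rate q alpha D : 5 <= q -> 0 < alpha < 1 -> 1 <= D ->
  q * (2 * expR (- ((15 * D * (Num.sqrt (ln q) + Num.sqrt (ln (2 / alpha)))) ^+ 2 /
    (2 * (34 * D ^+ 2))))) <= alpha / 8.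
Proof.
move=> q5 /andP[a0 a1] D1; set tau := 15 * D * _; have q0 : 0 < q by lra.
have D0 : 0 < D by lra.
have L0 : 0 <= ln q by rewrite ln_ge0//; lra.
have a2 : 0 < 2 / alpha by rewrite divr_gt0.
have l0 : 0 <= ln (2 / alpha) by rewrite ln_ge0// ler_pdivlMr//; lra.
have Lam2 : ln q + ln (2 / alpha) <= (Num.sqrt (ln q) + Num.sqrt (ln (2 / alpha))) ^+ 2.
  rewrite sqrrD !sqr_sqrtr//.
  have := mulr_ge0 (sqrtr_ge0 (ln q)) (sqrtr_ge0 (ln (2 / alpha))); lra.
have tauE : tau ^+ 2 / (2 * (34 * D ^+ 2)) =
    225 / 68 * (Num.sqrt (ln q) + Num.sqrt (ln (2 / alpha))) ^+ 2.
  by rewrite /tau; field; exact: lt0r_neq0.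
have h : expR (- (tau ^+ 2 / (2 * (34 * D ^+ 2)))) <= q^-1 ^+ 3 * (alpha / 2) ^+ 3.
  have -> : q^-1 ^+ 3 * (alpha / 2) ^+ 3 = expR (- (3 * (ln q + ln (2 / alpha)))).
    rewrite expRN expRM_natl expRD !lnK ?posrE//; field; apply/andP; split; exact: lt0r_neq0.
  by rewrite ler_expR tauE lerN2; lra.
have qi : 0 < q^-1 by rewrite invr_gt0.
have qi5 : q^-1 <= 5^-1 by rewrite lef_pV2 ?posrE.
apply: (@le_trans _ _ (q * (2 * (q^-1 ^+ 3 * (alpha / 2) ^+ 3)))).
  by rewrite ler_pM2l// ler_pM2l.
have -> : q * (2 * (q^-1 ^+ 3 * (alpha / 2) ^+ 3)) = (2 * q^-1 ^+ 2) * (alpha ^+ 3 / 8).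
  by field; exact: lt0r_neq0.
have h2 : q^-1 ^+ 2 <= 2^-1 by nra.
have h3 : alpha ^+ 3 <= alpha by rewrite -[leRHS]expr1; apply: ler_wiXn2l => //; exact: ltW.
have h4 : 0 <= alpha ^+ 3 by rewrite exprn_ge0// ltW.
have := sqr_ge0 q^-1; nra.
Qed.

(* 34^2 / 2 >= 18^2 + 15^2, for the separation, noise and bootstrap levels. *)
Lemma signal_dominates (G nd S D Lam m T : R) : 0 < G -> 0 <= S -> 0 < D -> 0 <= Lam ->
  0 <= T -> 0 <= m -> m <= 18 * D * Lam -> 34 * D * Num.sqrt S * Lam / G <= nd ->
  (G * nd) ^+ 2 / 2 - S * m ^+ 2 <= T ^+ 2 ->
  Num.sqrt S * (15 * D * Lam) <= T.
Proof.
move=> G0 S0 D0 Lam0 T0 m0 mLam; rewrite ler_pdivrMr// [nd * G]mulrC => gnd low.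
set r := Num.sqrt S in gnd *; have r0 : 0 <= r by exact: sqrtr_ge0.
have SE : S = r ^+ 2 by rewrite sqr_sqrtr.
have DL : 0 <= D * Lam by rewrite mulr_ge0// ltW.
rewrite -(@ler_pXn2r _ 2%N)// ?nnegrE//; last by rewrite mulr_ge0// -mulrA mulr_ge0.
apply: le_trans low; rewrite SE.
have h1 : (34 * D * r * Lam) ^+ 2 <= (G * nd) ^+ 2.
  have x0 : 0 <= 34 * D * r * Lam by rewrite !mulr_ge0// ltW.
  by apply: lerXn2r; rewrite ?nnegrE// (le_trans x0).
have h2 : m ^+ 2 <= (18 * D * Lam) ^+ 2.
  by apply: lerXn2r; rewrite ?nnegrE// (le_trans m0).
have h3 := ler_wpM2l (sqr_ge0 r) h2.
have h4 : 0 <= (D * r * Lam) ^+ 2 by exact: sqr_ge0.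
have e1 : (34 * D * r * Lam) ^+ 2 = 1156 * (D * r * Lam) ^+ 2 by ring.
have e2 : r ^+ 2 * (18 * D * Lam) ^+ 2 = 324 * (D * r * Lam) ^+ 2 by ring.
have -> : (r * (15 * D * Lam)) ^+ 2 = 225 * (D * r * Lam) ^+ 2 by ring.
lra.
Qed.
End Numeric.

(** * Coordinate directions are sparse unit vectors, so (A1) controls each entry *)

Section Coordinates.
Context {R : realType} {p1 p2 : nat}.

Lemma sum_delta_mx (j : 'I_p1) (k : 'I_p2) (f : R -> 'I_p1 -> 'I_p2 -> R) :
  (forall j' k', f 0 j' k' = 0) ->
  \sum_(j' < p1) \sum_(k' < p2) f ((delta_mx j k : 'M[R]_(p1, p2)) j' k') j' k' = f 1 j k.
Proof.
move=> f0; rewrite pair_big (bigD1 (j, k))//= mxE !eqxx/= big1 ?addr0// => -[j' k'] /=.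
by rewrite xpair_eqE mxE => /negbTE ->.
Qed.

Lemma sparse_unit_delta (j : 'I_p1) (k : 'I_p2) :
  sparse_unit (delta_mx j k : 'M[R]_(p1, p2)).
Proof.
split.
  by rewrite (@sum_delta_mx j k (fun x _ _ => x ^+ 2)) ?expr1n// => *; rewrite expr0n.
rewrite (eq_card (B := pred1 (j, k))) => [|[j' k']].
  by rewrite card1 leq_max (leq_ltn_trans _ (ltn_ord j)).
by rewrite !inE/= mxE xpair_eqE; case: (_ && _); rewrite ?oner_eq0 ?eqxx.
Qed.

Lemma lin_delta (j : 'I_p1) (k : 'I_p2) (A : 'M[R]_(p1, p2)) :
  lin (delta_mx j k) A = A j k.
Proof.
by rewrite /lin (@sum_delta_mx j k (fun x j' k' => x * A j' k')) ?mul1r// => *; rewrite mul0r.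
Qed.
End Coordinates.

(** * Power of the bootstrap test *)

Theorem theorem4 (R : realType) (b1 b2 : R) :
  0 < b1 -> b1 <= b2 ->
  exists c1 c2 : R, 0 < c1 /\ 0 < c2 /\
  forall (d : measure_display) (T : measurableType d) (P : probability T R)
    (p1 p2 N nu u B mode : nat) (mu delta : 'M[R]_(p1, p2))
    (eps : 'I_N -> T -> 'M[R]_(p1, p2)) (e : 'I_B -> 'I_N -> T -> R)
    (DN alpha : R),
    (0 < p1)%N -> (0 < p2)%N -> (0 < B)%N ->
    (1 < u < N)%N -> (1 < nu)%N -> (nu.*2 < N)%N -> (nu <= u <= N - nu)%N ->
    norminf delta <= 1 -> 1 <= DN -> 0 < alpha < 1 ->
    (mode = 1%N \/ mode = 2%N) ->
    (* measurability *)
    (forall i j1 j2, measurable_fun setT (fun w => eps i w j1 j2)) ->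
    (forall b i, measurable_fun setT (e b i)) ->
    (* eps_1..eps_N and all e^b_i mutually independent *)
    indep_groups P all_groups (all_vars eps e) ->
    (* e^b_i ~ N(0,1) *)
    (forall b i (A : set R), measurable A ->
       P (e b i @^-1` A) = normal_prob 0 1 A) ->
    (* zero mean *)
    (forall i j1 j2, P.-integrable setT (fun w => (eps i w j1 j2)%:E) /\
       (\int[P]_w (eps i w j1 j2)%:E = 0)%E) ->
    (* (A1) *)
    (forall i (v : 'M[R]_(p1, p2)), sparse_unit v ->
       (\int[P]_w (expR (`|lin v (eps i w)| / DN))%:E <= 2%:E)%E) ->
    (* (A2) *)
    (forall i (v : 'M[R]_(p1, p2)), sparse_unit v ->
       ((b1 ^+ 2)%:E <= \int[P]_w ((lin v (eps i w)) ^+ 2)%:E)%E /\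
       (\int[P]_w ((lin v (eps i w)) ^+ 4)%:E <= (DN ^+ 2 * b2 ^+ 2)%:E)%E) ->
    let X := fun w (i : 'I_N) =>
      mu + (if (u <= i)%N then delta else 0) + eps i w in
    let s := if mode == 1%N then p2 else p1 in
    let eta := (DN ^+ 2 * s%:R ^+ 5 * (ln ((p1 * p2 * N)%N%:R)) ^+ 5 / nu%:R)
                 `^ (4%:R^-1) in
    c1 * DN * Num.sqrt s%:R *
      (Num.sqrt (ln ((p1 * p2 * N)%N%:R)) + Num.sqrt (ln (2 / alpha)))
      / Num.sqrt ((u * (N - u))%N%:R / N%:R) <= norm_mode mode delta ->
    ((1 - c2 * eta - 2 * expR (- (alpha ^+ 2 * B%:R / 2)))%:E <=
     P [set w | (boot_quantile (fun b => Tboot mode nu (fun i => e b i w) (X w)) alpha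
                <= Tstat mode nu (X w))%R])%E.
Proof.
(* 34 is the signal level of [signal_dominates]; 6 collects three noise events of probability at
   most 2 / q each. *)
move=> b1_gt0 b12; exists 34, 6; split; [by []|split=> //].
move=> d T P p1 p2 N nu u B mode mu delta eps e D alpha p1_gt0 p2_gt0 B_gt0 uN nu1 nu2N nu_u
  delta1 D1 alpha01 _ meps me ind gauss mean subexp _ X s eta sep.
have nu_gt0 : (0 < nu)%N by exact: ltnW.
have uN' : (0 < u < N)%N by case/andP: uN => /ltnW -> ->.
have Nq : (N <= p1 * p2 * N)%N by rewrite leq_pmull// muln_gt0 p1_gt0.
(* From nu >= 2 and 2 nu < N. It gives q >= 5 > exp 1, hence L >= 1. *)
have N5 : (5 <= N)%N.
  by apply: leq_trans nu2N; have := leq_double 2 nu; rewrite nu1.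
have nuN : (nu <= N)%N by rewrite (leq_trans _ (ltnW nu2N))// -addnn leq_addr.
have [q qE] : exists q : R, q = (p1 * p2 * N)%N%:R by exists (p1 * p2 * N)%N%:R.
have q5 : 5 <= q by rewrite qE ler_nat (leq_trans N5).
have q0 : 0 < q by exact: lt_le_trans q5.
have nuq : nu%:R <= q by rewrite qE ler_nat (leq_trans nuN).
have L1 : 1 <= ln (p1 * p2 * N)%N%:R :> R.
  rewrite -qE -[leLHS]expRK ler_ln ?posrE ?expR_gt0//.
  by apply: (le_trans expR1_le4); apply: le_trans q5; rewrite ler_nat.
have mX i j k : measurable_fun setT (fun w => X w i j k).
  by rewrite /X; under eq_fun do rewrite mxE; exact: measurable_funD.
pose Tb b w := Tboot mode nu (fun i => e b i w) (X w).
pose Ts w := Tstat mode nu (X w).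
have mT : measurable_fun setT Ts by exact: measurable_Tstat.
have mTb b : measurable_fun setT (Tb b) by exact: measurable_Tboot.
pose Ev' := [set w | 1 - alpha <= B%:R^-1 * \sum_(b < B) ((Tb b w <= Ts w)%R)%:R].
set Ev := [set w | _].
(* Trading the quantile for a count of replicates makes the event visibly measurable. *)
have EvE : Ev = Ev'.
  by apply/seteqP; split => w; rewrite /Ev /Ev'/= boot_quantile_le.
have mEv' : measurable Ev'.
  apply: measurable_set_ler => //; apply: measurable_funM => //.
  apply: measurable_sum => b; apply: measurable_boolR; exact: measurable_fun_ler.
rewrite EvE {EvE Ev}.
have [eta6|eta6] := leP 1 (6 * eta).
  apply: (@le_trans _ _ 0%E) => //; rewrite lee_fin.
  have := expR_ge0 (- (alpha ^+ 2 * B%:R / 2)); lra.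
have nu0 : 0 < nu%:R :> R by rewrite ltr0n.
have s1 : 1 <= s%:R :> R by rewrite ler1n /s; case: ifP.
have [nuL q_eta] := @rate_small R D s%:R (ln (p1 * p2 * N)%N%:R) nu%:R q D1 s1 L1 nu0 nuq eta6.
have eps_exp i j k : (\int[P]_w (expR (`|eps i w j k| / D))%:E <= 2%:E)%E.
  have := subexp i _ (sparse_unit_delta j k).
  by under eq_integral do rewrite lin_delta.
have [mbad Pbad] := measurable_noise_bad meps me ind D1 mean eps_exp nu_gt0 nu_u L1 nuL.
pose bad := noise_bad eps D nu u.
pose Lam := Num.sqrt (ln (p1 * p2 * N)%N%:R) + Num.sqrt (ln (2 / alpha)) : R.
have D0 : 0 < D by exact: lt_le_trans D1.
have Lam0 : 0 < Lam by rewrite ltr_wpDr ?sqrtr_ge0// sqrtr_gt0 (lt_le_trans _ L1).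
have V0 : 0 < 34 * D ^+ 2 by rewrite mulr_gt0// exprn_gt0.
have tau0 : 0 < 15 * D * Lam by rewrite !mulr_gt0.
pose A (i : 'I_N) := mu + (if (u <= i)%N then delta else 0).
have tail b (x : 'I_N -> 'M[R]_(p1, p2)) : boot_var nu x <= 34 * D ^+ 2 ->
   (P [set w | (Num.sqrt (mode_size mode p1 p2)%:R * (15 * D * Lam) < Tboot mode nu (fun i => e b i w) x)%R] <=
    (alpha / 8)%:E)%E.
  move=> xV; have BT := boot_tail meps me ind gauss mode b nu_gt0 V0 tau0 xV.
  apply: (le_trans BT).
  by rewrite lee_fin /Lam -qE; exact: gauss_rate.
have [r0 r8 ra] : [/\ 0 <= alpha / 8, 8 * (alpha / 8) <= alpha & alpha <= 1].
  by case/andP: alpha01 => *; split; lra.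
have [mexc Pexc] := @boot_exceed _ _ _ P _ _ _ _ eps e meps me ind A mode nu
  (34 * D ^+ 2) (Num.sqrt (mode_size mode p1 p2)%:R * (15 * D * Lam)) (alpha / 8) alpha r0 r8 ra tail.
set exc := [set w | _] in mexc Pexc.
have sub : ~` (bad `|` exc) `<=` Ev'.
  move=> w /not_orP[nbad nexc].
  have xV : boot_var nu (X w) <= 34 * D ^+ 2 by exact: noise_good_var.
  have count : \sum_(b < B) ((Num.sqrt (mode_size mode p1 p2)%:R * (15 * D * Lam) < Tb b w)%R)%:R < alpha * B%:R :> R.
    by rewrite ltNge; apply/negP => h; apply: nexc; split.
  have big : Num.sqrt (mode_size mode p1 p2)%:R * (15 * D * Lam) <= Ts w.
    apply: (le_trans _ (cusum_le_Tstat mode (X w) nu_u)).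
    rewrite /X cusum_shift//.
    set G := Num.sqrt (u%:R * _ / _).
    have G0 : 0 < G.
      have /andP[u0 ultN] := uN'.
      by rewrite sqrtr_gt0 divr_gt0 ?mulr_gt0 ?ltr0n ?subn_gt0// (leq_trans _ N5).
    have GE : Num.sqrt ((u * (N - u))%N%:R / N%:R) = G by rewrite /G natrM.
    move: sep; rewrite GE => sep.
    apply: (signal_dominates G0 _ D0 (ltW Lam0) _ _ _ sep
      (norm_mode_lower mode delta G p1_gt0 p2_gt0
        (noise_good_cusum nbad))) => //.
    - exact: norm_mode_ge0.
    - by rewrite !mulr_ge0 ?sqrtr_ge0// ltW.
    - rewrite -!mulrA ler_pM2l// mulrC ler_pM2l// /Lam lerDl; exact: sqrtr_ge0.
  rewrite /Ev'/=.
  have BR : 0 < B%:R :> R by rewrite ltr0n.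
  rewrite mulrC ler_pdivlMr//.
  (* Replicates not above the level are at most T(X), and fewer than alpha B are above it. *)
  apply: (@le_trans _ _ (\sum_(b < B) (1 - ((Num.sqrt (mode_size mode p1 p2)%:R * (15 * D * Lam) < Tb b w)%R)%:R))).
    rewrite sumrB sumr_const card_ord; move: count; set c := \sum_(b < B) _; lra.
  apply: ler_sum => b _; case: (ltP (Num.sqrt (mode_size mode p1 p2)%:R * (15 * D * Lam)) (Tb b w)) => h /=.
    by rewrite subrr.
  by rewrite (le_trans h big) subr0.
have mU : measurable (bad `|` exc) by exact: measurableU.
have PU : (P (bad `|` exc) <= (6 / q + expR (- (alpha ^+ 2 * B%:R / 2)))%:E)%E.
  rewrite EFinD; apply: (le_trans (measureU2 _ _ _)) => //.
  by apply: leeD => //; rewrite qE.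
apply: (@le_trans _ _ (P (~` (bad `|` exc)))); last first.
  by apply: le_measure; rewrite ?inE//; exact: measurableC.
rewrite probability_setC//.
apply: (@le_trans _ _ (1%:E - (6 / q + expR (- (alpha ^+ 2 * B%:R / 2)))%:E)%E).
  rewrite -EFinB lee_fin; have q6 : 6 / q <= 6 * eta by rewrite ler_pM2l//; exact: q_eta.
  have := expR_ge0 (- (alpha ^+ 2 * B%:R / 2)); lra.
exact: leeB.
Qed.
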